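(* Let $\Pi=(t_k)_{k\in\mathbb{Z}}$ be a sampling sequence with constants $0<\delta\le\Delta$, let $\chi$ be a kernel satisfying $(\chi1)$–$(\chi4)$ with associated function $L$ and $\varphi$-function $\psi$ (from $(\chi3)$), and suppose $L$ satisfies $(L1)$ and $(L2)$. Let $\varphi$ be a convex $\varphi$-function satisfying condition (H) with a convex $\varphi$-function $\eta$, and let $f\in L^{\varphi+\eta}(\mathbb{R})$. Fix $0<\alpha<1$ and suppose there are constants $M_1>0$, $\alpha_0>0$ (depending on $\alpha$ and $L$) such that $$ w\int_{|y|>1/w^{\alpha}} L(wy)\,dy\le M_1 w^{-\alpha_0}$$ for all sufficiently large $w>0$. Then there exist $\mu>0$, $\lambda_0>0$ and $\lambda>0$ such that, with $\omega(f,\delta')_\eta:=\sup_{|t|\le\delta'} I^{\eta}[\lambda(f(\cdot+t)-f(\cdot))]$, for every sufficiently large $w>0$, $$I^{\varphi}[\mu(S_wf-f)]\le \frac{\|L\|_1}{3\delta\, m_{0,\Pi}(L)}\,\omega(f,1/w^{\alpha})_\eta+\frac{M_1 I^{\eta}[\lambda_0 f]}{3\delta\, m_{0,\Pi}(L)}\,w^{-\alpha_0}+\frac{\Delta}{3\delta}\,\omega(f,\Delta/w)_\eta+\frac{I^{\varphi}[\lambda_0 f]}{3}\,w^{-\theta_0},$$ where $\theta_0>0$ is the constant of condition $(\chi4)$.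
   Context: A $\varphi$-function is a continuous non-decreasing $\varphi:[0,\infty)\to[0,\infty)$ with $\varphi(0)=0$, $\varphi(u)>0$ for $u>0$, and $\varphi(u)\to+\infty$ as $u\to+\infty$. For a $\varphi$-function $\varphi$ and measurable $f:\mathbb{R}\to\mathbb{R}$, $I^{\varphi}[f]:=\int_{\mathbb{R}}\varphi(|f(x)|)\,dx$, and the Orlicz space is $L^{\varphi}(\mathbb{R})=\{f \text{ measurable}: I^{\varphi}[\lambda f]<\infty \text{ for some }\lambda>0\}$; $L^{\varphi+\eta}(\mathbb{R})$ is the Orlicz space generated by the $\varphi$-function $\varphi+\eta$. A sampling sequence $\Pi=(t_k)_{k\in\mathbb{Z}}$ is a sequence of reals with $t_k<t_{k+1}$, $t_k\to\pm\infty$ as $k\to\pm\infty$, and constants $0<\delta\le\Delta$ with $\delta\le \Delta_k:=t_{k+1}-t_k\le\Delta$ for all $k$. A kernel is $\chi:\mathbb{R}\times\mathbb{R}\to\mathbb{R}$ with: $(\chi1)$ $k\mapsto\chi(wx-t_k,u)\in\ell^1(\mathbb{Z})$ for all $(x,u)\in\mathbb{R}^2$, $w>0$; $(\chi2)$ $\chi(x,0)=0$ for all $x$; $(\chi3)$ there exist a measurable $L:\mathbb{R}\to[0,\infty)$ and a $\varphi$-function $\psi$ with $|\chi(x,u)-\chi(x,v)|\le L(x)\psi(|u-v|)$ for all $x,u,v$; $(\chi4)$ there is $\theta_0>0$ such that $\mathcal{T}_w(x):=\sup_{u\ne0}\left|\frac1u\sum_{k}\chi(wx-t_k,u)-1\right|=\mathcal{O}(w^{-\theta_0})$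 as $w\to+\infty$, uniformly in $x\in\mathbb{R}$. Conditions on $L$: $(L1)$ $L\in L^1(\mathbb{R})$ and $L$ is bounded in a neighborhood of $0$; $(L2)$ there is $\beta_0>0$ with $\sup_{u\in\mathbb{R}}\sum_k L(u-t_k)|u-t_k|^{\beta_0}<+\infty$. Set $m_{0,\Pi}(L):=\sup_{u\in\mathbb{R}}\sum_k L(u-t_k)$ (finite under $(L1)$,$(L2)$). Condition (H): there is a $\varphi$-function $\eta$ such that for every $\lambda\in(0,1)$ there is $C_\lambda\in(0,1)$ with $\varphi(C_\lambda\psi(u))\le\eta(\lambda u)$ for all $u\ge0$, where $\psi$ is from $(\chi3)$. The nonlinear sampling Kantorovich operators are $(S_wf)(x):=\sum_{k\in\mathbb{Z}}\chi\!\left(wx-t_k,\frac{w}{\Delta_k}\int_{t_k/w}^{t_{k+1}/w}f(u)\,du\right)$, $x\in\mathbb{R}$, $w>0$, for locally integrable $f$ for which the series converges for every $x$. *)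

(* Defs.v *)
From HB Require Import structures.
From mathcomp Require Import all_boot all_order all_algebra.
From mathcomp Require Import all_classical all_reals all_analysis.
Set Implicit Arguments. Unset Strict Implicit. Unset Printing Implicit Defensive.
Import Order.TTheory GRing.Theory Num.Theory.
Import numFieldNormedType.Exports.
Local Open Scope classical_set_scope.
Local Open Scope ring_scope.

Section Defs.
Variable R : realType.
Local Notation leb := (@lebesgue_measure R).

(* phi-function: continuous, non-decreasing on [0,oo), phi 0 = 0,
   positive on (0,oo), tends to +oo.  Only values on [0,oo) matter. *)
Definition phi_function (phi : R -> R) : Prop :=
  [/\ {within `[0, +oo[, continuous phi},
      (forall u v : R, 0 <= u -> u <= v -> phi u <= phi v),
      phi 0 = 0,
      (forall u : R, 0 < u -> 0 < phi u)
    & phi x @[x --> +oo] --> +oo].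

Definition convex_on_nonneg (phi : R -> R) : Prop :=
  forall u v t : R, 0 <= u -> 0 <= v -> 0 <= t <= 1 ->
    phi (t * u + (1 - t) * v) <= t * phi u + (1 - t) * phi v.

Definition modular (phi : R -> R) (f : R -> R) : \bar R :=
  (\int[leb]_(x in setT) (phi `|f x|)%:E)%E.

Definition orlicz (phi : R -> R) (f : R -> R) : Prop :=
  measurable_fun setT f /\
  exists lam : R, 0 < lam /\ (modular phi (fun x => (lam * f x)%R) < +oo)%E.

Definition sampling_seq (t : int -> R) (delta Delta : R) : Prop :=
  [/\ 0 < delta /\ delta <= Delta,
      (forall k : int, t k < t (k + 1)),
      (forall k : int, delta <= t (k + 1) - t k <= Delta),
      t (n%:Z) @[n --> \oo] --> +oo
    & t (- n%:Z) @[n --> \oo] --> -oo].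

Definition zsummable (a : int -> R) : Prop :=
  (\esum_(k in [set: int]) (`|a k|)%:E < +oo)%E.

(* sum over Z (limit of the partial sums over -n <= k < n; equals the
   usual sum for l^1 sequences) *)
Definition zsum (a : int -> R) : R :=
  limn (fun n : nat => \sum_(0 <= i < n) (a i%:Z + a (- (i.+1)%:Z))).

Definition zesum (a : int -> R) : \bar R :=
  \esum_(k in [set: int]) (a k)%:E.

Definition Dk (t : int -> R) (k : int) : R := t (k + 1) - t k.

Definition kantorovich (chi : R -> R -> R) (t : int -> R) (w : R)
    (f : R -> R) (x : R) : R :=
  zsum (fun k => chi (w * x - t k)
          (w / Dk t k * Rintegral leb `[t k / w, t (k + 1) / w] f)).

Definition chi1 (chi : R -> R -> R) (t : int -> R) : Prop :=
  forall (x u w : R), 0 < w -> zsummable (fun k => chi (w * x - t k) u).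

Definition chi2 (chi : R -> R -> R) : Prop := forall x : R, chi x 0 = 0.

Definition chi3 (chi : R -> R -> R) (L psi : R -> R) : Prop :=
  measurable_fun setT L /\ (forall x, 0 <= L x) /\ phi_function psi /\
  forall x u v : R, `|chi x u - chi x v| <= L x * psi `|u - v|.

(* T_w(x) = sup_{u<>0} |(1/u) sum_k chi(wx - t_k, u) - 1| = O(w^{-theta0})
   as w -> +oo, uniformly in x *)
Definition chi4 (chi : R -> R -> R) (t : int -> R) (theta0 : R) : Prop :=
  0 < theta0 /\
  exists C W : R, 0 < W /\ forall w x u : R, W < w -> u != 0 ->
    `| u^-1 * zsum (fun k => chi (w * x - t k) u) - 1| <= C * w `^ (- theta0).

Definition L1cond (L : R -> R) : Prop :=
  leb.-integrable setT (EFin \o L) /\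
  exists r M : R, 0 < r /\ forall x : R, `|x| < r -> L x <= M.

Definition L2cond (L : R -> R) (t : int -> R) : Prop :=
  exists beta0 : R, 0 < beta0 /\
  exists B : R, forall u : R,
    (zesum (fun k => (L (u - t k) * `|u - t k| `^ beta0)%R) <= B%:E)%E.

(* m_{0,Pi}(L) = sup_u sum_k L(u - t_k)  (finite under (L1),(L2)) *)
Definition m0 (L : R -> R) (t : int -> R) : R :=
  fine (ereal_sup [set zesum (fun k => L (u - t k)) | u in [set: R]]).

Definition L1norm (L : R -> R) : R := Rintegral leb setT (fun x => `|L x|).

Definition condH (phi psi eta : R -> R) : Prop :=
  forall lam : R, 0 < lam < 1 -> exists C : R, 0 < C < 1 /\
    forall u : R, 0 <= u -> phi (C * psi u) <= eta (lam * u).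

Definition omega (eta : R -> R) (lam : R) (f : R -> R) (d : R) : \bar R :=
  ereal_sup [set modular eta (fun x => lam * (f (x + s) - f x)) | s in [set s | `|s| <= d]].

End Defs.

(* Main.v *)
(* Insert, between S_w f and f, the sums P = sum_k chi(wx - t_k, b_k(x)), where
   b_k(x) is the mean of f over [x, x + Delta_k/w], and
   Q = sum_k chi(wx - t_k, f(x)).  Convexity of phi splits the modular of
   mu (S_w f - f) into three modulars, each with factor 1/3.  For S_w f - P and
   P - Q, (chi3) bounds the difference by sum_k L(wx - t_k) psi(..); Jensen for
   the weights L(wx - t_k)/m_0, condition (H), and Jensen for the means reduce
   everything to integrals of eta(lambda |f(. + y) - f|).  For S_w f - P the
   cells [t_k/w, t_(k+1)/w] tile the line, which leaves
   w int L(wy) I^eta[lambda (f(. + y) - f)] dy; the part |y| <= w^(-alpha) gives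
   the modulus of smoothness and the rest is the tail of L.  Q - f is
   controlled by (chi4). *)
Require Import Defs.
From HB Require Import structures.
From mathcomp Require Import all_boot all_order all_algebra.
From mathcomp Require Import all_classical all_reals all_analysis.
From mathcomp Require Import measurable_realfun.
From mathcomp Require Import ring lra.
Set Implicit Arguments. Unset Strict Implicit. Unset Printing Implicit Defensive.
Import Order.TTheory GRing.Theory Num.Theory.
Import numFieldNormedType.Exports.
Local Open Scope classical_set_scope.
Local Open Scope ring_scope.

(** * Convex functions on the half-line *)

(** The means in P run over [x, x + Delta_k/w], exactly as long as the k-th cell, so S_w f - P
    compares f at x + v and at t_k/w + v with the same v. These points differ by x - t_k/w; after x
    is translated by t_k/w this becomes a shift y independent of k and v, and the kernel becomes
    L(wy). The two differences treat the weights differently. In S_w f - P the sum over k is spent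
    on the tiling, so 1/m_0 survives, next to 1/delta from 1/Delta_k <= 1/delta. In P - Q the bound
    is made uniform in k, so the weights sum out and m_0 disappears; the price is Delta/delta, from
    enlarging every interval to length Delta/w while dividing by delta/w. Two facts must be secured
    first: m_0 > 0, which comes from (chi4), and convergence of the series S_w f and P, whose second
    argument varies with k while (chi1) fixes it. The latter rests on one constant bounding all the
    means of f, obtained from the convexity of eta. *)

Section convexity.
Context {R : realType}.
Variable phi : R -> R.
Hypothesis phi_mono : forall u v : R, 0 <= u -> u <= v -> phi u <= phi v.
Hypothesis phi00 : phi 0 = 0.
Hypothesis phi_convex : convex_on_nonneg phi.

Lemma nonneg_of_mono u : 0 <= u -> 0 <= phi u.
Proof. by move=> u0; rewrite -phi00 phi_mono. Qed.

(** This is convexity at [m], written as the combination of [u] and [v] with weight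
    [(v - m) / (v - u)], with denominators cleared. *)
Lemma three_slopes u m v : 0 <= u -> u < m -> m < v ->
  (phi m - phi u) * (v - m) <= (phi v - phi m) * (m - u).
Proof.
move=> u0 um mv.
have vu : 0 < v - u by lra.
have t01 : 0 <= (v - m) / (v - u) <= 1.
  by rewrite divr_ge0 ?ler_pdivrMr//=; lra.
have v0 : 0 <= v by lra.
have := @phi_convex _ _ _ u0 v0 t01.
have -> : (v - m) / (v - u) * u + (1 - (v - m) / (v - u)) * v = m.
  by field; lra.
have -> : (v - m) / (v - u) * phi u + (1 - (v - m) / (v - u)) * phi v =
  ((v - m) * phi u + (m - u) * phi v) / (v - u) by field; lra.
rewrite ler_pdivlMr//; lra.
Qed.

(* The constant term [-b] of the minorant is nonpositive, so Jensen follows for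
   weights of total mass at most one, with no summability hypothesis. *)
Lemma supporting_line m : 0 <= m -> exists a b : R,
  [/\ 0 <= a, 0 <= b, a * m = phi m + b &
      forall v, 0 <= v -> a * v <= phi v + b].
Proof.
rewrite le_eqVlt => /predU1P[<-|m0].
  exists 0, 0; split=> //; first by rewrite phi00; lra.
  by move=> v v0; rewrite mul0r addr0 nonneg_of_mono.
(* The slope [a] is the supremum of the slopes of chords ending at [m] from the left, that is, the
   left derivative. Every chord to the right of [m] bounds it from above, and the chord from 0 gives
   [b >= 0]. *)
pose S := [set (phi m - phi u) / (m - u) | u in [set u : R | 0 <= u < m]].
have slope_ub v : m < v -> ubound S ((phi v - phi m) / (v - m)).
  move=> mv _ [u /= /andP[u0 um] <-].
  rewrite ler_pdivrMr ?subr_gt0// mulrAC ler_pdivlMr ?subr_gt0//.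
  exact: three_slopes.
have S0 : S ((phi m - phi 0) / (m - 0)) by exists 0 => //=; rewrite lexx.
have hsS : has_sup S.
  split; first by eexists; exact: S0.
  by exists ((phi (m + 1) - phi m) / (m + 1 - m)); apply: slope_ub; lra.
have supS u : 0 <= u < m -> (phi m - phi u) / (m - u) <= sup S.
  by move=> um; apply: ub_le_sup; [exact: hsS.2|exists u].
have am : phi m <= sup S * m.
  by rewrite -ler_pdivrMr//; have := supS 0; rewrite phi00 !subr0; apply; rewrite lexx.
exists (sup S), (sup S * m - phi m); split => //.
- by rewrite (le_trans _ (supS 0 _)) ?lexx// phi00 !subr0 divr_ge0// ?nonneg_of_mono// ltW.
- by rewrite subr_ge0.
- by rewrite addrC subrK.
move=> v v0; case: (ltgtP v m) => [vm|mv|->]; last by rewrite addrC subrK.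
- have := supS v; rewrite v0 vm => /(_ isT).
  by rewrite ler_pdivrMr ?subr_gt0//; lra.
- have : sup S <= (phi v - phi m) / (v - m).
    by apply: ge_sup; [exact: hsS.1|exact: slope_ub].
  by rewrite ler_pdivlMr ?subr_gt0//; lra.
Qed.

Lemma convex_star c u : 0 <= c <= 1 -> 0 <= u -> phi (c * u) <= c * phi u.
Proof.
move=> c01 u0; have := @phi_convex u 0 c u0 (lexx 0) c01.
by rewrite phi00 !mulr0 !addr0.
Qed.

Lemma convex_half a b : 0 <= a -> 0 <= b -> phi (a + b) <= (phi (2 * a) + phi (2 * b)) / 2.
Proof.
move=> a0 b0.
have h01 : is_true (0 <= (2^-1:R) <= 1) by lra.
have a2 : 0 <= 2 * a by lra.
have b2 : 0 <= 2 * b by lra.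
have := @phi_convex (2 * a) (2 * b) 2^-1 a2 b2 h01.
have -> : 2^-1 * (2 * a) + (1 - 2^-1) * (2 * b) = a + b by field.
lra.
Qed.

Lemma convex_third a b c : 0 <= a -> 0 <= b -> 0 <= c ->
  phi (a + b + c) <= (phi (3 * a) + phi (3 * b) + phi (3 * c)) / 3.
Proof.
move=> a0 b0 c0.
have t01 : is_true (0 <= (3^-1:R) <= 1) by lra.
have a3 : 0 <= 3 * a by lra.
(* The weights are 1/3 on [3 * a] and 2/3 on this point; the latter is then split in half between
   [3 * b] and [3 * c]. *)
have d0 : 0 <= 3 / 2 * (b + c) by lra.
have := @phi_convex _ _ 3^-1 a3 d0 t01.
have -> : 3^-1 * (3 * a) + (1 - 3^-1) * (3 / 2 * (b + c)) = a + b + c by field.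
move=> /le_trans; apply.
have b' : 0 <= 3 / 2 * b by lra.
have c' : 0 <= 3 / 2 * c by lra.
have := convex_half b' c'.
have -> : 3 / 2 * b + 3 / 2 * c = 3 / 2 * (b + c) by lra.
have -> : 2 * (3 / 2 * b) = 3 * b by field.
have -> : 2 * (3 / 2 * c) = 3 * c by field.
lra.
Qed.

(** Monotonicity is known on the half-line only; clipping the argument at 0 gives a function
    monotone on the whole line, hence Borel, that agrees with [phi] on norms. *)
Lemma measurable_comp_norm : measurable_fun setT (fun x : R => phi `|x|).
Proof.
have -> : (fun x : R => phi `|x|) = (fun x => phi (Num.max x 0)) \o (fun x => `|x|).
  by apply/funext => x /=; rewrite max_l.
apply: measurableT_comp => //; apply: nondecreasing_measurable => // x y xy.
apply: phi_mono; first by rewrite le_max lexx orbT.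
by rewrite ge_max !le_max lexx xy orbT.
Qed.

End convexity.

(** * Sums over the integers and Jensen inequalities *)

Section sums.
Context {R : realType}.

Lemma esumZl (T : choiceType) (a : T -> \bar R) (r : R) : 0 <= r ->
  (forall i, (0 <= a i)%E) ->
  (\esum_(i in setT) (r%:E * a i) = r%:E * \esum_(i in setT) a i)%E.
Proof.
move=> r0 a0; rewrite /esum -ereal_supZl//; last first.
  by apply/set0P; eexists; exists set0 => //; exact: fsets_set0.
congr ereal_sup; apply/seteqP; split => [_ [A fA <-]|_ [_ [A fA <-] <-]] /=.
  by exists (\sum_(x \in A) a x)%E; [exists A|rewrite ge0_mule_fsumr].
by exists A => //; rewrite ge0_mule_fsumr.
Qed.

(** The pairing of n with -(n+1) is that of [zsum]; it follows the two constructors of [int] and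
    makes results on series over the naturals available. *)
Lemma esum_int (a : int -> \bar R) : (forall k, (0 <= a k)%E) ->
  (\esum_(k in [set: int]) a k = \sum_(0 <= n <oo) (a n%:Z + a (- (n.+1)%:Z)%R))%E.
Proof.
move=> a0; rewrite (esumID (range Posz))// !setTI.
have -> : ~` range Posz = range Negz.
  apply/seteqP; split => [[n|n] /= H|_ [n _ <-] [m _]//]; last by exists n.
  by exfalso; apply: H; exists n.
rewrite !esum_image; try by move=> x y _ _ [].
by rewrite -!nneseries_esumT// nneseriesD.
Qed.

Lemma esum_int_partial (a : int -> \bar R) n : (forall k, (0 <= a k)%E) ->
  (\sum_(0 <= i < n) (a i%:Z + a (- (i.+1)%:Z)%R) <= \esum_(k in [set: int]) a k)%E.
Proof.
move=> a0; rewrite esum_int//.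
by apply: (@nneseries_lim_ge R _ xpredT 0%N n) => k _ _; exact: adde_ge0.
Qed.

Lemma esum_int_le (a : int -> \bar R) c : (forall k, (0 <= a k)%E) ->
  (forall n, (\sum_(0 <= i < n) (a i%:Z + a (- (i.+1)%:Z)%R) <= c)%E) ->
  (\esum_(k in [set: int]) a k <= c)%E.
Proof.
move=> a0 h; rewrite esum_int//; apply: lime_le; last exact: nearW.
by apply: is_cvg_nneseries => k _ _; exact: adde_ge0.
Qed.

Lemma measurable_esum_int d (T : measurableType d) (g : int -> T -> \bar R) :
  (forall k x, (0 <= g k x)%E) -> (forall k, measurable_fun setT (g k)) ->
  measurable_fun setT (fun x => \esum_(k in [set: int]) g k x)%E.
Proof.
move=> g0 mg.
under eq_fun do rewrite esum_int//.
have -> : (fun x => \sum_(0 <= n <oo) (g n%:Z x + g (- (n.+1)%:Z)%R x))%E =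
    (fun x => \sum_(n <oo | n \in xpredT) (g n%:Z x + g (- (n.+1)%:Z)%R x))%E.
  by apply/funext => x; apply: eq_eseriesl.
apply: ge0_emeasurable_sum => k //=; first by move=> *; exact: adde_ge0.
by move=> _; exact: emeasurable_funD.
Qed.

Lemma integral_esum_int d (T : measurableType d) (mu : {measure set T -> \bar R})
    (g : int -> T -> \bar R) :
  (forall k x, (0 <= g k x)%E) -> (forall k, measurable_fun setT (g k)) ->
  (\int[mu]_x (\esum_(k in [set: int]) g k x) =
   \esum_(k in [set: int]) \int[mu]_x g k x)%E.
Proof.
move=> g0 mg; under eq_integral do rewrite esum_int//.
rewrite esum_int; last by move=> k; exact: integral_ge0.
rewrite integral_nneseries//.
- by apply: eq_eseriesr => n _; rewrite ge0_integralD.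
- by move=> n; exact: emeasurable_funD.
- by move=> n x _; exact: adde_ge0.
Qed.

Lemma zsum0 : zsum (fun=> 0 : R) = 0.
Proof.
by rewrite /zsum; under eq_fun do rewrite big1 ?addr0//; rewrite lim_cst.
Qed.

Lemma zsum_cvg (a : int -> R) : zsummable a ->
  cvgn (fun n : nat => \sum_(0 <= i < n) (a i%:Z + a (- (i.+1)%:Z)%R)).
Proof.
move=> sa; apply: (@normed_cvg R R (fun i => a i%:Z + a (- (i.+1)%:Z)%R)).
apply: nondecreasing_is_cvgn.
  by apply/nondecreasing_series => i _ _; exact: normr_ge0.
exists (fine (\esum_(k in [set: int]) (`|a k|)%:E)%E) => _ [n _ <-].
rewrite -lee_fin fineK; last first.
  by rewrite ge0_fin_numE//; apply: esum_ge0 => k _; rewrite lee_fin.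
apply: (le_trans _ (@esum_int_partial (fun k => (`|a k|)%:E) n _)); last by move=> k; rewrite lee_fin.
rewrite /series/= -sumEFin; apply: lee_sum => i _.
by rewrite -EFinD lee_fin ler_normD.
Qed.

Lemma zsum_dist (a b : int -> R) : zsummable a -> zsummable b ->
  ((`|zsum a - zsum b|)%:E <= \esum_(k in [set: int]) (`|a k - b k|)%:E)%E.
Proof.
move=> /zsum_cvg ca /zsum_cvg cb.
set c := esum _ _.
have part n : ((`|\sum_(0 <= i < n) (a i%:Z + a (- (i.+1)%:Z)%R) -
    \sum_(0 <= i < n) (b i%:Z + b (- (i.+1)%:Z)%R)|)%:E <= c)%E.
  apply: (le_trans _ (@esum_int_partial (fun k => (`|a k - b k|)%:E) n _)); last by move=> k; rewrite lee_fin.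
  rewrite -sumrB; apply: (@le_trans _ _ (\sum_(0 <= i < n) (`|(a i%:Z + a (- (i.+1)%:Z)) - (b i%:Z + b (- (i.+1)%:Z))|)%:E)%E).
    by rewrite sumEFin lee_fin; exact: ler_norm_sum.
  apply: lee_sum => i _.
  rewrite -EFinD lee_fin (_ : _ - _ = (a i%:Z - b i%:Z) + (a (- i.+1%:Z)%R - b (- i.+1%:Z)%R)).
    exact: ler_normD.
  by rewrite opprD addrACA.
(* An infinite bound is trivial, and the empty partial sum excludes [-oo]. *)
move: c part; case=> [r| |] part; [|by rewrite leey|by have := part 0%N].
rewrite lee_fin.
have cab : (fun n => `|\sum_(0 <= i < n) (a i%:Z + a (- (i.+1)%:Z)) -
    \sum_(0 <= i < n) (b i%:Z + b (- (i.+1)%:Z))|) @ \oo --> `|zsum a - zsum b|.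
  by apply: cvg_norm; apply: cvgB.
rewrite -(cvg_lim _ cab)//; apply: limr_le; first exact: cvgP cab.
by apply: nearW => n; rewrite -lee_fin; exact: part.
Qed.

Lemma zsummable_le (a b : int -> R) : (forall k, `|a k| <= b k) ->
  (zesum b < +oo)%E -> zsummable a.
Proof.
by move=> ab; apply: le_lt_trans; apply: le_esum => k _; rewrite lee_fin.
Qed.

End sums.

Section jensen.
Context {R : realType}.
Variable phi : R -> R.
Hypothesis phi_mono : forall u v : R, 0 <= u -> u <= v -> phi u <= phi v.
Hypothesis phi00 : phi 0 = 0.
Hypothesis phi_convex : convex_on_nonneg phi.

(** Summing the affine minorant at [m] against [p] gives [phi m + b] on the left and at most the
    wanted sum plus [b] on the right, because the mass is at most one and [b >= 0]. As [a >= 0], an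
    upper bound of [m] by the weighted sum suffices in place of equality. *)
Lemma jensen_esum (T : choiceType) (p v : T -> R) (m : R) :
  (forall k, 0 <= p k) -> (forall k, 0 <= v k) -> 0 <= m ->
  (\esum_(k in setT) (p k)%:E <= 1)%E ->
  (m%:E <= \esum_(k in setT) (p k * v k)%:E)%E ->
  ((phi m)%:E <= \esum_(k in setT) (p k * phi (v k))%:E)%E.
Proof.
move=> p0 v0 m0 p1 mle.
have [a [b [a0 b0 abm abv]]] := supporting_line phi_mono phi00 phi_convex m0.
rewrite -(@leeD2rE _ b%:E)// -EFinD -abm EFinM.
apply: le_trans; first by apply: lee_wpmul2l mle; rewrite lee_fin.
rewrite -esumZl//; last by move=> i; rewrite lee_fin mulr_ge0.
apply: (@le_trans _ _ (\esum_(k in setT) ((p k * phi (v k))%:E + b%:E * (p k)%:E))%E).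
  apply: le_esum => k _; rewrite -!EFinM -EFinD lee_fin.
  by rewrite mulrCA (mulrC b) -mulrDr ler_wpM2l// abv.
rewrite esumD; last 2 first.
- by move=> i _; rewrite lee_fin mulr_ge0// nonneg_of_mono.
- by move=> i _; rewrite mule_ge0// lee_fin.
rewrite (@esumZl _ _ (fun k => (p k)%:E) _ b0)//.
apply: leeD2l; apply: (@le_trans _ _ (b%:E * 1)%E); last by rewrite mule1.
by apply: lee_wpmul2l => //; rewrite lee_fin.
Qed.

(** The same supporting line is integrated over [D]; the normalised mass is exactly one, so the
    constant [b] reproduces itself and cancels. *)
Lemma jensen_integral d (T : measurableType d) (mu : {measure set T -> \bar R})
    (D : set T) (g : T -> R) (h m : R) :
  measurable D -> 0 < h -> mu D = h%:E -> measurable_fun D g -> 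
  (forall x, 0 <= g x) -> 0 <= m ->
  (m%:E <= h^-1%:E * \int[mu]_(x in D) (g x)%:E)%E ->
  ((phi m)%:E <= h^-1%:E * \int[mu]_(x in D) (phi (g x))%:E)%E.
Proof.
move=> mD h0 muD mg g0 m0 mle.
have [a [b [a0 b0 abm abv]]] := supporting_line phi_mono phi00 phi_convex m0.
have mphig : measurable_fun D (phi \o g).
  have -> : phi \o g = (fun x => phi `|x|) \o g.
    by apply/funext => x /=; rewrite ger0_norm.
  by apply: measurableT_comp => //; exact: measurable_comp_norm.
have phig0 x : 0 <= phi (g x) by exact: nonneg_of_mono.
have hi0 : 0 <= h^-1 by rewrite invr_ge0 ltW.
rewrite -(@leeD2rE _ b%:E)// -EFinD -abm EFinM.
apply: le_trans; first by apply: lee_wpmul2l mle; rewrite lee_fin.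
rewrite muleCA -ge0_integralZl_EFin//; last 2 first.
- by move=> x _; rewrite lee_fin.
- exact/measurable_EFinP.
have -> : (b%:E = h^-1%:E * \int[mu]_(x in D) b%:E)%E.
  by rewrite integral_cst// muD -!EFinM mulrCA mulVf ?mulr1// gt_eqF.
rewrite -ge0_muleDr; last 2 first.
- by apply: integral_ge0 => x _; rewrite lee_fin.
- by apply: integral_ge0 => x _; rewrite lee_fin.
rewrite -ge0_integralD//; last 2 first.
- by move=> x _; rewrite lee_fin.
- exact/measurable_EFinP.
apply: lee_wpmul2l; first by rewrite lee_fin.
apply: ge0_le_integral => //.
- by move=> x _; rewrite mule_ge0 ?lee_fin.
- by apply/measurable_EFinP; exact: measurable_funM.
- by apply: emeasurable_funD => //; exact/measurable_EFinP.
- by move=> x _; rewrite -EFinM -EFinD lee_fin abv.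
Qed.

End jensen.

(** * Affine changes of variable for the Lebesgue integral *)

Section lebesgue_affine.
Context {R : realType}.
Local Notation leb := (@lebesgue_measure R).

Lemma pushforward_shift (a : R) (A : set R) : measurable A ->
  pushforward leb ((fun x => x + a) : measurableTypeR R -> measurableTypeR R) A = leb A.
Proof.
move=> mA; apply/esym.
have mshift : measurable_fun setT ((fun x => x + a) : measurableTypeR R -> measurableTypeR R).
  exact: measurable_funD.
apply: (lebesgue_measure_unique _ mA) => // _ [[x y]] _ <-.
rewrite /pushforward.
transitivity (leb `]x - a, y - a]%classic); last first.
  by congr (leb _); apply/seteqP; split => z /=; rewrite !in_itv/= ltrBlDr lerBrDr.
by rewrite !lebesgue_measure_itv/= !lte_fin ltrD2r -!EFinB opprB addrA subrK.
Qed.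

Lemma ge0_integral_shift (D : set R) (g : R -> \bar R) (a : R) :
  measurable D -> measurable_fun setT g -> (forall x, (0 <= g x)%E) ->
  (\int[leb]_(x in (fun x => x + a)%R @^-1` D) g (x + a)%R = \int[leb]_(x in D) g x)%E.
Proof.
move=> mD mg g0.
have mshift : measurable_fun setT ((fun x => x + a) : measurableTypeR R -> measurableTypeR R).
  exact: measurable_funD.
have := ge0_integral_pushforward mshift leb mD (measurable_funS measurableT (@subsetT _ _) mg).
rewrite /= => <-; last by [].
by apply: eq_measure_integral => A mA _; exact: pushforward_shift.
Qed.

Lemma ge0_integral_shiftT (g : R -> \bar R) (a : R) :
  measurable_fun setT g -> (forall x, (0 <= g x)%E) ->
  (\int[leb]_x g (x + a)%R = \int[leb]_x g x)%E.
Proof. by move=> mg g0; rewrite -(@ge0_integral_shift setT g a). Qed.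

Lemma itv_shift (a b c : R) :
  (fun x => x + c) @^-1` `[a + c, b + c]%classic = `[a, b]%classic.
Proof. by apply/seteqP; split => z /=; rewrite !in_itv/= !lerD2r. Qed.

Lemma ge0_integral_shift_itv (g : R -> \bar R) (a h : R) :
  measurable_fun setT g -> (forall x, (0 <= g x)%E) ->
  (\int[leb]_(v in `[0%R, h]) g (a + v)%R = \int[leb]_(x in `[a, (a + h)%R]) g x)%E.
Proof.
move=> mg g0; rewrite -(@ge0_integral_shift _ g a)//.
have -> : (fun x => x + a) @^-1` `[a, a + h]%classic = `[0, h]%classic.
  by rewrite -(itv_shift 0 h a) add0r (addrC h).
by apply: eq_integral => x _; rewrite addrC.
Qed.

Lemma Rintegral_shift_itv (f : R -> R) (a h : R) : measurable_fun setT f ->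
  Rintegral leb `[0, h] (fun v => f (a + v)) = Rintegral leb `[a, a + h] f.
Proof.
move=> mf; rewrite /Rintegral; congr fine; rewrite integralE [RHS]integralE.
have mf' : measurable_fun setT (EFin \o f) by exact/measurable_EFinP.
rewrite -[X in _ = (X - _)%E]ge0_integral_shift_itv//; last exact: measurable_funepos.
rewrite -[X in _ = (_ - X)%E]ge0_integral_shift_itv//; last exact: measurable_funeneg.
by congr (_ - _)%E; apply: eq_integral => x _; rewrite ?funeposE ?funenegE.
Qed.

Lemma ge0_integral_scale (g : R -> \bar R) (w : R) : 0 < w ->
  measurable_fun setT g -> (forall x, (0 <= g x)%E) ->
  (w%:E * \int[leb]_x g (w * x)%R = \int[leb]_x g x)%E.
Proof.
move=> w0 mg g0.
have mmul : measurable_fun setT ((fun x => w * x) : measurableTypeR R -> measurableTypeR R).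
  exact: measurable_funM.
have := ge0_integral_pushforward mmul leb measurableT mg (fun x _ => g0 x).
rewrite preimage_setT /= => <-.
have wnn : 0 <= w by exact: ltW.
(* [m] is [w] times the image of Lebesgue measure under dilation by [w]. It gives half-open
   intervals their length, so uniqueness identifies it with Lebesgue measure. *)
pose m' : {measure set (measurableTypeR R) -> \bar R} :=
  mscale (NngNum wnn) (pushforward leb ((fun x => w * x) : measurableTypeR R -> measurableTypeR R)).
pose m := m' mmul.
transitivity (\int[m]_x g x)%E.
  by rewrite ge0_integral_mscale.
apply: eq_measure_integral => A mA _; apply/esym.
apply: (lebesgue_measure_unique _ mA) => // _ [[x y]] _ <-.
transitivity (w%:E * leb `](x / w)%R, (y / w)%R]%classic)%E; last first.
  by congr (_ * leb _)%E; apply/seteqP; split => z /=; rewrite !in_itv/= ltr_pdivrMr// ler_pdivlMr// mulrC.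
rewrite !lebesgue_measure_itv/= !lte_fin ltr_pM2r ?invr_gt0//.
case: ifP => _; last by rewrite mule0.
by rewrite -!EFinB -EFinM -mulrBl mulrCA mulfV ?mulr1// gt_eqF.
Qed.

(** The integral of a nonnegative function is a supremum over simple functions below it, hence
    monotone for arbitrary functions. This lets S_w f - f be integrated through its measurable
    majorants. *)
Lemma ge0_le_integral_nonmeasurable (f g : R -> \bar R) :
  (forall x, (0 <= f x)%E) -> (forall x, (f x <= g x)%E) ->
  (\int[leb]_x f x <= \int[leb]_x g x)%E.
Proof.
move=> f0 fg.
have g0 x : (0 <= g x)%E by exact: le_trans (f0 x) (fg x).
rewrite !ge0_integralTE//; apply: ge_ereal_sup => _ [h /= hf <-].
by apply: ereal_sup_ubound; exists h => //= x; exact: le_trans (hf x) (fg x).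
Qed.

End lebesgue_affine.

(** * Sampling sequences and the discrete moment of the kernel *)

Section sampling.
Context {R : realType}.
Local Notation leb := (@lebesgue_measure R).

Lemma ge0_integral_itv_cat (F : R -> \bar R) (a b c : R) : a <= b -> b <= c ->
  measurable_fun setT F -> (forall x, (0 <= F x)%E) ->
  (\int[leb]_(x in `[a, c]) F x =
   \int[leb]_(x in `[a, b]) F x + \int[leb]_(x in `[b, c]) F x)%E.
Proof.
move=> ab bc mF F0.
have mFS (D : set R) : measurable D -> measurable_fun D F.
  by move=> mD; exact: measurable_funS mF.
rewrite -[X in (_ + X)%E]integral_itv_obnd_cbnd; last exact: mFS.
rewrite -ge0_integral_setU//.
- by rewrite -itv_bndbnd_setU ?bnd_simp.
- by apply: mFS; exact: measurableU.
- apply/disj_setPS => x [] /=; rewrite !in_itv/= => /andP[_ xb] /andP[bx _].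
  by move: (lt_le_trans bx xb); rewrite ltxx.
Qed.

(** The cells with indices from -n to n - 1 glue to the single interval from [s (-n)] to [s n],
    whose integral is at most the integral over the line. The induction carries the order of the
    endpoints, which the gluing needs. *)
Lemma esum_integral_itv_le (s : int -> R) (F : R -> \bar R) :
  (forall k, s k <= s (k + 1)) ->
  measurable_fun setT F -> (forall x, (0 <= F x)%E) ->
  (\esum_(k in [set: int]) \int[leb]_(x in `[s k, s (k + 1)%R]) F x
     <= \int[leb]_x F x)%E.
Proof.
move=> smono mF F0; apply: esum_int_le => [k|n]; first exact: integral_ge0.
suff [H1 [H2 ->]] : s (- n%:Z) <= s 0 /\ s 0 <= s n%:Z /\
    (\sum_(0 <= i < n) (\int[leb]_(x in `[s i%:Z, s (i%:Z + 1)%R]) F x +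
      \int[leb]_(x in `[s (- (i.+1)%:Z)%R, s (- (i.+1)%:Z + 1)%R]) F x) =
    \int[leb]_(x in `[s (- n%:Z)%R, s n%:Z]) F x)%E.
  by apply: ge0_subset_integral => //; exact: measurable_funS mF.
elim: n => [|n [IH1 [IH2 IH3]]].
  by rewrite oppr0 lexx big_geq// set_itv1 integral_set1.
have e1 : n%:Z + 1 = n.+1%:Z by rewrite -addn1 PoszD.
have e2 : - n.+1%:Z + 1 = - n%:Z by rewrite -e1 opprD subrK.
have m1 := smono n%:Z; have m2 := smono (- n.+1%:Z).
rewrite e1 in m1; rewrite e2 in m2.
split; first exact: le_trans IH1. split; first exact: le_trans m1.
rewrite big_nat_recr//= IH3 e1 e2.
rewrite (@ge0_integral_itv_cat F (s (- n.+1%:Z)) (s (- n%:Z)) (s n.+1%:Z))//; last first.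
  exact: le_trans (le_trans IH1 IH2) m1.
rewrite (@ge0_integral_itv_cat F (s (- n%:Z)) (s n%:Z) (s n.+1%:Z))//; last first.
  exact: le_trans IH2.
by rewrite [RHS]addeC addeA.
Qed.

Lemma esum_telescope_le (g : int -> R) (A B : R) :
  (forall k, g k <= g (k + 1)) -> (forall k, A <= g k <= B) ->
  (\esum_(k in [set: int]) (g (k + 1) - g k)%:E <= (B - A)%:E)%E.
Proof.
move=> gmono gb; apply: esum_int_le => [k|n]; first by rewrite lee_fin subr_ge0.
have -> : (\sum_(0 <= i < n) ((g (i%:Z + 1) - g i%:Z)%:E +
   (g (- (i.+1)%:Z + 1) - g (- (i.+1)%:Z))%:E) = (g n%:Z - g (- n%:Z))%:E)%E.
  elim: n => [|n IH]; first by rewrite big_geq// oppr0 subrr.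
  have e1 : n%:Z + 1 = n.+1%:Z by rewrite -addn1 PoszD.
  have e2 : - n.+1%:Z + 1 = - n%:Z by rewrite -e1 opprD subrK.
  by rewrite big_nat_recr//= IH e1 e2 -!EFinD; congr EFin; lra.
by rewrite lee_fin; have := gb n%:Z; have := gb (- n%:Z); lra.
Qed.

(** Nodes closer than [r] to [u] contribute at most [M] each, and their spacing [delta] limits their
    number. For the others [|u - t k| ^ b >= r ^ b], so (L2) bounds their sum by [B / r ^ b]. Both
    bounds are nonnegative, hence their sum majorises every term. *)
Lemma zesum_kernel_bound (L : R -> R) (t : int -> R) (delta Delta : R) :
  sampling_seq t delta Delta -> (forall x, 0 <= L x) -> L1cond L -> L2cond L t ->
  exists K : R, forall u, (zesum (fun k => L (u - t k)%R) <= K%:E)%E.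
Proof.
move=> [[d0 _] _ tk _ _] L0 [_ [r [M [r0 LM]]]] [b [b0 [B LB]]].
have M0 : 0 <= M by apply: le_trans (L0 0) _; apply: LM; rewrite normr0.
exists ((r `^ b)^-1 * B + M / delta * (r + delta - - r)) => u.
(* [G] climbs by at least [delta] across every node within distance [r] of [u],
   so its bounded telescoping sum counts these nodes. *)
pose G k := Num.max (- r) (Num.min (t k - u) (r + delta)).
have Gmono k : G k <= G (k + 1).
  have ts := tk k; apply: le_max2 => //; apply: le_min2 => //; lra.
have Gb k : - r <= G k <= r + delta.
  by rewrite le_max lexx/= ge_max ge_min lexx orbT andbT; lra.
have rb : 0 < r `^ b by exact: powR_gt0.
apply: (@le_trans _ _ (\esum_(k in [set: int])
   ((r `^ b)^-1%:E * (L (u - t k) * `|u - t k| `^ b)%:E +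
    (M / delta)%:E * (G (k + 1) - G k)%:E))%E).
  apply: le_esum => k _; rewrite -!EFinM -EFinD lee_fin.
  case: (ltP `|u - t k| r) => ur.
    have ts := tk k.
    (* The cap [r + delta], rather than [r], leaves room for a full step of [delta] from the last
       near node. *)
    have Gk : delta <= G (k + 1) - G k.
      move: ur; rewrite ltr_norml => /andP[ur1 ur2].
      rewrite /G (@min_l _ _ (t k - u)); last lra.
      rewrite (@max_r _ _ (- r) (t k - u)); last lra.
      rewrite lerBrDr le_max; apply/orP; right; rewrite le_min; lra.
    apply: (@le_trans _ _ (0 + M)); first by rewrite add0r; exact: LM.
    apply: lerD; first by rewrite !mulr_ge0// ?invr_ge0 ?powR_ge0.
    rewrite -mulrA ler_peMr// mulrC ler_pdivlMr// mul1r//.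
  apply: (@le_trans _ _ (L (u - t k) + 0)); first by rewrite addr0.
  apply: lerD.
    rewrite mulrCA ler_peMr// ler_pdivlMl// mulr1.
    by apply: ge0_ler_powR; rewrite ?nnegrE// ltW.
  by rewrite mulr_ge0 ?divr_ge0 ?subr_ge0// ltW.
rewrite esumD; last 2 first.
- by move=> k _; rewrite -EFinM lee_fin !mulr_ge0// ?invr_ge0 powR_ge0.
- by move=> k _; rewrite -EFinM lee_fin mulr_ge0 ?divr_ge0 ?subr_ge0// ltW.
rewrite esumZl ?invr_ge0 ?powR_ge0//; last first.
  by move=> k; rewrite lee_fin mulr_ge0// powR_ge0.
rewrite esumZl ?divr_ge0 ?(ltW d0)//; last by move=> k; rewrite lee_fin subr_ge0.
rewrite EFinD !EFinM; apply: leeD.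
  by apply: lee_wpmul2l; [rewrite lee_fin invr_ge0 powR_ge0|exact: LB].
apply: lee_wpmul2l; first by rewrite -EFinM lee_fin divr_ge0// ltW.
exact: esum_telescope_le.
Qed.

(** [m0] is defined by [fine], which would send an infinite supremum to 0; the uniform bound [K]
    rules this out. *)
Lemma zesum_le_m0 (L : R -> R) (t : int -> R) :
  (forall x, 0 <= L x) ->
  (exists K : R, forall u, (zesum (fun k => L (u - t k)%R) <= K%:E)%E) ->
  forall u, (zesum (fun k => L (u - t k)%R) <= (m0 L t)%:E)%E.
Proof.
move=> L0 [K LK] u; rewrite /m0 fineK; first by apply: ereal_sup_ubound; exists u.
have S0 : (0 <= ereal_sup [set zesum (fun k => L (u - t k)%R) | u in [set: R]])%E.
  apply: le_trans (ereal_sup_ubound _); last by exists 0.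
  by apply: esum_ge0 => k _; rewrite lee_fin.
rewrite ge0_fin_numE//; apply: (@le_lt_trans _ _ K%:E); last exact: ltry.
by apply: ge_ereal_sup => _ [v _ <-]; exact: LK.
Qed.

Lemma powR_opp_small (C theta W : R) : 0 < theta ->
  exists w : R, [/\ W < w, 0 < w & C * w `^ (- theta) < 1].
Proof.
move=> th0.
pose c := `|C| + 1.
have c0 : 0 < c by rewrite /c; have := normr_ge0 C; lra.
(* The second entry forces [w ^ theta >= |C| + 1 > C]. *)
pose w := Num.max (`|W| + 1) (c `^ theta^-1).
have w0 : 0 < w by rewrite /w lt_max; apply/orP; left; have := normr_ge0 W; lra.
exists w; split => //.
  by rewrite /w lt_max; apply/orP; left; have := ler_norm W; lra.
rewrite powRN ltr_pdivrMr ?mul1r ?powR_gt0//.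
apply: (@lt_le_trans _ _ c); first by rewrite /c; apply: (le_lt_trans (ler_norm C)); rewrite ltrDl ltr01.
rewrite -[leLHS]powRr1 ?(ltW c0)// -(@mulVf _ theta) ?gt_eqF// powRrM.
by apply: ge0_ler_powR; rewrite ?nnegrE ?powR_ge0 ?(ltW th0) ?(ltW w0)// /w le_max lexx orbT.
Qed.

(** Otherwise [L] vanishes at all the points [u - t k], so by (chi2) and (chi3) the sum in (chi4) at
    [u = 1] is 0, and (chi4) would give [1 <= C * w ^ (- theta0)] for all large [w]. *)
Lemma m0_gt0 (chi : R -> R -> R) (L psi : R -> R) (t : int -> R) (theta0 : R) :
  chi2 chi -> chi3 chi L psi -> chi4 chi t theta0 ->
  (forall u, (zesum (fun k => L (u - t k)%R) <= (m0 L t)%:E)%E) -> 0 < m0 L t.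
Proof.
move=> c2 [_ [L0 [_ c3]]] [th0 [C [W [W0 c4]]]] Lm0.
rewrite ltNge; apply/negP => m0le.
have Lz u k : L (u - t k) = 0.
  apply/eqP; rewrite eq_le L0 andbT -lee_fin.
  apply: le_trans (le_trans (Lm0 u) _); last by rewrite lee_fin; exact: m0le.
  apply: esum_ge; exists [set k]; last by rewrite fsbig_set1.
  by split => //; exact: finite_set1.
have [w [Ww w0 Cw]] := powR_opp_small C W th0.
have := c4 w 0 1 Ww (oner_neq0 _).
have -> : (fun k => chi (w * 0 - t k) 1) = (fun=> 0).
  apply/funext => k; apply/eqP; rewrite -normr_le0.
  by have := c3 (w * 0 - t k) 1 0; rewrite c2 subr0 Lz mul0r.
by rewrite zsum0 mulr0 sub0r normrN1; lra.
Qed.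

End sampling.

(** * Means of a function of finite modular *)

Section section_integrals.
Context {R : realType}.
Local Notation leb := (@lebesgue_measure R).
Variables (G : measurableTypeR R -> measurableTypeR R -> \bar R) (D : set R).
Hypothesis mD : measurable D.
Hypothesis G0 : forall x y, (0 <= G x y)%E.
Hypothesis mG : measurable_fun setT (fun p : measurableTypeR R * measurableTypeR R => G p.1 p.2).

(** Cutting [G] off outside [D] in the second variable turns integrals over [D] into integrals over
    the line, where Tonelli applies. *)
Let GD (p : measurableTypeR R * measurableTypeR R) : \bar R := (G p.1 \_ D) p.2.

Let GD0 p : (0 <= GD p)%E.
Proof. by rewrite /GD patchE; case: ifP. Qed.

Let mGD : measurable_fun setT GD.
Proof.
have -> : GD = (fun p => G p.1 p.2 * (\1_D p.2)%:E)%E.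
  apply/funext => p; rewrite /GD patchE indicE.
  by case: (_ \in _); rewrite ?mule1 ?mule0.
apply: emeasurable_funM => //; apply/measurable_EFinP.
by apply: measurableT_comp => //; exact: measurable_indic.
Qed.

Lemma measurable_section_integral :
  measurable_fun setT (fun x : measurableTypeR R => \int[leb]_(y in D) G x y)%E.
Proof.
under eq_fun do rewrite integral_mkcond.
exact: (@measurable_fun_fubini_tonelli_F _ _ _ _ _ leb GD mGD GD0).
Qed.

Lemma integral_section_swap :
  (\int[leb]_x \int[leb]_(y in D) G x y = \int[leb]_(y in D) \int[leb]_x G x y)%E.
Proof.
under eq_integral do rewrite integral_mkcond.
rewrite [RHS]integral_mkcond.
rewrite (@fubini_tonelli _ _ _ _ _ leb leb GD mGD GD0).
apply: eq_integral => y _; rewrite /GD patchE /=.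
under eq_integral do rewrite patchE.
by case: (y \in D) => //; rewrite integral0.
Qed.

End section_integrals.

Section averages.
Context {R : realType}.
Local Notation leb := (@lebesgue_measure R).

Lemma avg_dist (g1 g2 : R -> R) (h : R) : 0 < h ->
  leb.-integrable `[0, h] (EFin \o g1) -> leb.-integrable `[0, h] (EFin \o g2) ->
  ((`|h^-1 * Rintegral leb `[0, h] g1 - h^-1 * Rintegral leb `[0, h] g2|)%:E
   <= h^-1%:E * \int[leb]_(v in `[0%R, h]) (`|g1 v - g2 v|)%:E)%E.
Proof.
move=> h0 i1 i2; have hi0 : 0 <= h^-1 by rewrite invr_ge0 ltW.
rewrite -mulrBr -RintegralB// normrM (ger0_norm hi0) EFinM.
apply: lee_wpmul2l; first by rewrite lee_fin.
have i12 : leb.-integrable `[0, h] (EFin \o (fun v => g1 v - g2 v)).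
  rewrite (_ : _ \o _ = (EFin \o g1) \- (EFin \o g2))%E//.
  exact: integrableB.
rewrite EFin_normr_Rintegral//.
by apply: (le_trans (le_abse_integral _ _ _)) => //; case/integrableP: i12.
Qed.

Lemma mean_cst (h c : R) : 0 < h -> h^-1 * Rintegral leb `[0, h] (fun=> c) = c.
Proof.
move=> h0; rewrite Rintegral_cst//= lebesgue_measure_itv/= lte_fin h0 sube0/=.
by rewrite mulrCA mulVf ?mulr1// gt_eqF.
Qed.

Variables (eta f : R -> R) (lam0 : R).
Hypothesis eta_phi : phi_function eta.
Hypothesis eta_convex : convex_on_nonneg eta.
Hypothesis mf : measurable_fun setT f.
Hypothesis lam00 : 0 < lam0.
Hypothesis eta_fin : (modular eta (fun x => lam0 * f x)%R < +oo)%E.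

(** The supporting line of [eta] at 1 has slope [a = eta 1 + b > 0], so [|f|] is at most
    [(eta (lam0 * |f|) + b) / (a * lam0)]. The modular over an interval is at most the one over the
    line, whence a bound independent of the position of the interval. *)
Lemma integral_norm_translate_bound (H : R) : 0 <= H ->
  exists B : R, forall a,
    (\int[leb]_(v in `[0%R, H]) (`|f (a + v)%R|)%:E <= B%:E)%E.
Proof.
move=> H0; have [_ emono e0 epos _] := eta_phi.
have [a [b [a0 b0 ab abv]]] := supporting_line emono e0 eta_convex ler01.
have {}a0 : 0 < a.
  by rewrite -[a]mulr1 ab; apply: ltr_wpDr => //; apply: epos.
have mod_fin : modular eta (fun x => lam0 * f x) \is a fin_num.
  rewrite ge0_fin_numE//; apply: integral_ge0 => x _.
  by rewrite lee_fin; exact: nonneg_of_mono.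
have al : 0 <= (a * lam0)^-1 by rewrite invr_ge0 mulr_ge0// ltW.
have mcomp (g : R -> R) : measurable_fun setT g -> measurable_fun setT (fun x => eta `|g x|).
  by move=> mg; exact: (measurableT_comp (measurable_comp_norm emono) mg).
exists ((a * lam0)^-1 * (fine (modular eta (fun x => lam0 * f x)) + b * H)) => c.
have mfc : measurable_fun setT (fun v => f (c + v)).
  by apply: (measurableT_comp mf); exact: measurable_funD.
have mIS (D : set R) (g : R -> \bar R) : measurable D -> measurable_fun setT g -> measurable_fun D g.
  by move=> mD; exact: measurable_funS.
apply: (@le_trans _ _ (\int[leb]_(v in `[0%R, H])
    ((a * lam0)^-1%:E * ((eta `|lam0 * f (c + v)|)%:E + b%:E)))%E).
  apply: ge0_le_integral => //.
  - by apply: mIS => //; apply/measurable_EFinP; exact: measurableT_comp.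
  - apply: mIS => //; apply/measurable_EFinP; apply: measurable_funM => //.
    by apply: measurable_funD => //; apply: mcomp; exact: measurable_funM.
  - move=> x _; rewrite -EFinD -EFinM lee_fin ler_pdivlMl ?mulr_gt0//.
    by have := abv `|lam0 * f (c + x)| (normr_ge0 _); rewrite normrM (gtr0_norm lam00) mulrA.
rewrite ge0_integralZl_EFin//; last 2 first.
- by move=> x _; rewrite -EFinD lee_fin addr_ge0// nonneg_of_mono.
- apply: mIS => //; apply/measurable_EFinP.
  by apply: measurable_funD => //; apply: mcomp; exact: measurable_funM.
rewrite EFinM; apply: lee_wpmul2l; first by rewrite lee_fin.
rewrite ge0_integralD//; last 2 first.
- by move=> x _; rewrite lee_fin nonneg_of_mono.
- by apply: mIS => //; apply/measurable_EFinP; apply: mcomp; exact: measurable_funM.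
rewrite EFinD; apply: leeD; last first.
  rewrite integral_cst//= lebesgue_measure_itv/= lte_fin.
  by case: ifP => [_|/negbT]; [rewrite sube0 EFinM|rewrite -leNgt mule0 lee_fin mulr_ge0].
rewrite fineK//.
have mg : measurable_fun setT (fun x => (eta `|lam0 * f x|)%:E).
  by apply/measurable_EFinP; apply: mcomp; exact: measurable_funM.
rewrite (@ge0_integral_shift_itv _ (fun x => (eta `|lam0 * f x|)%:E))//; last first.
  by move=> x; rewrite lee_fin nonneg_of_mono.
apply: ge0_subset_integral => //.
by move=> x _; rewrite lee_fin nonneg_of_mono.
Qed.

Lemma integrable_translate (H a : R) : 0 <= H ->
  leb.-integrable `[0, H] (EFin \o (fun v => f (a + v))).
Proof.
move=> H0; have [B HB] := integral_norm_translate_bound H0.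
apply/integrableP; split.
  apply: (@measurable_funS _ _ _ _ setT) => //; apply/measurable_EFinP.
  by apply: (measurableT_comp mf); exact: measurable_funD.
by apply: (le_lt_trans (HB a)); exact: ltry.
Qed.

(** The bound is uniform in both base point and length, so that [kernel_summable] applies with one
    [B] to all the means. *)
Lemma avg_bound (h0 H : R) : 0 < h0 -> h0 <= H -> exists B : R, forall a h, h0 <= h <= H ->
  `|h^-1 * Rintegral leb `[0, h] (fun v => f (a + v))| <= B.
Proof.
move=> h00 h0H; have H0 : 0 <= H by lra.
have [B HB] := integral_norm_translate_bound H0.
have B0 : 0 <= B.
  by rewrite -lee_fin; apply: le_trans (HB 0); apply: integral_ge0.
exists (h0^-1 * B) => a h /andP[h0h hH].
have hp : 0 < h by lra.
rewrite normrM gtr0_norm ?invr_gt0//; apply: ler_pM => //.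
- by rewrite invr_ge0 ltW.
- by rewrite lef_pV2 ?posrE.
have hh : 0 <= h by lra.
rewrite -lee_fin EFin_normr_Rintegral//; last exact: integrable_translate.
have mfa : measurable_fun setT (fun v => f (a + v)).
  by apply: (measurableT_comp mf); exact: measurable_funD.
apply: le_trans (HB a).
apply: (le_trans (le_abse_integral _ _ _)) => //.
  by apply/measurable_EFinP; exact: measurable_funS mfa.
apply: ge0_subset_integral => //.
  apply: (@measurable_funS _ _ _ _ setT) => //; apply/measurable_EFinP.
  exact: measurableT_comp.
by apply: subset_itvl; rewrite bnd_simp.
Qed.

End averages.

(** * Modular estimates *)

Section kernel_estimates.
Context {R : realType}.
Local Notation leb := (@lebesgue_measure R).

Lemma kernel_summable (chi : R -> R -> R) (L psi : R -> R) (t : int -> R) (K B z : R)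
    (c : int -> R) :
  chi2 chi -> chi3 chi L psi ->
  (zesum (fun k => L (z - t k)%R) <= K%:E)%E -> (forall k, `|c k| <= B) ->
  zsummable (fun k => chi (z - t k) (c k)).
Proof.
move=> c2 [_ [L0 [[_ pmono p0 _ _] c3]]] LK cB.
apply: (@zsummable_le _ _ (fun k => psi B * L (z - t k))).
  move=> k; have := c3 (z - t k) (c k) 0; rewrite c2 !subr0 => /le_trans; apply.
  by rewrite mulrC ler_wpM2r//; apply: pmono.
have B0 : 0 <= B by apply: le_trans (cB 0); exact: normr_ge0.
have pB : 0 <= psi B by exact: nonneg_of_mono.
rewrite /zesum; under eq_esum do rewrite EFinM.
rewrite esumZl//; last by move=> k; rewrite lee_fin.
by apply: (@le_lt_trans _ _ ((psi B)%:E * K%:E)%E); [exact: lee_wpmul2l|exact: ltry].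
Qed.

(** Jensen with weights [L (z - t k) / m] and values [C * psi |c k - b k|]; the condition on [kappa]
    gives [kappa <= C / m], so by (chi3) the left argument is below the weighted sum. Condition (H)
    then replaces [phi (C * psi _)] by [eta (lam * _)]. *)
Lemma kernel_sum_modular (chi : R -> R -> R) (L psi phi eta : R -> R) (t : int -> R)
    (m C lam kappa z : R) (c b : int -> R) :
  chi3 chi L psi ->
  phi_function phi -> convex_on_nonneg phi ->
  (zesum (fun k => L (z - t k)%R) <= m%:E)%E -> 0 < m -> 0 < C ->
  (forall u, 0 <= u -> phi (C * psi u) <= eta (lam * u)) ->
  0 <= kappa -> kappa * m <= C ->
  zsummable (fun k => chi (z - t k) (c k)) ->
  zsummable (fun k => chi (z - t k) (b k)) ->
  ((phi (kappa * `|zsum (fun k => chi (z - t k) (c k)) -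
                   zsum (fun k => chi (z - t k) (b k))|))%:E <=
   m^-1%:E * \esum_(k in [set: int]) (L (z - t k) * eta (lam * `|c k - b k|))%:E)%E.
Proof.
move=> [_ [L0 [[_ pmono p0 _ _] c3]]] [_ fmono f0 _ _] fconv Lm m_gt0 C0 H k0 km sc sb.
have psi0 u : 0 <= u -> 0 <= psi u by exact: nonneg_of_mono.
have phi0 u : 0 <= u -> 0 <= phi u by exact: nonneg_of_mono.
have mi0 : 0 <= m^-1 by rewrite invr_ge0 ltW.
have Cm : kappa <= C / m by rewrite ler_pdivlMr.
apply: (@le_trans _ _ (\esum_(k in [set: int])
    ((m^-1 * L (z - t k)) * phi (C * psi `|c k - b k|))%:E)%E); last first.
  apply: (@le_trans _ _ (\esum_(k in [set: int])
      (m^-1%:E * (L (z - t k) * eta (lam * `|c k - b k|))%:E)%E)%E).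
    apply: le_esum => k _; rewrite -EFinM lee_fin -mulrA ler_wpM2l// ler_wpM2l//.
    exact: H.
  rewrite esumZl// => k; rewrite lee_fin mulr_ge0//.
  apply: le_trans (H _ (normr_ge0 _)); apply: phi0.
  by rewrite mulr_ge0 ?(ltW C0)// psi0.
apply: jensen_esum => //.
- by move=> k; rewrite mulr_ge0.
- by move=> k; rewrite mulr_ge0 ?(ltW C0)// psi0.
- by rewrite mulr_ge0.
- under eq_esum do rewrite EFinM.
  rewrite esumZl//; last by move=> k; rewrite lee_fin.
  apply: (@le_trans _ _ (m^-1%:E * m%:E)%E); first exact: lee_wpmul2l.
  by rewrite -EFinM mulVf// gt_eqF.
rewrite EFinM.
apply: (@le_trans _ _ (kappa%:E * \esum_(k in [set: int]) (`|chi (z - t k) (c k) - chi (z - t k) (b k)|)%:E)%E).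
  by apply: lee_wpmul2l; [rewrite lee_fin|exact: zsum_dist].
rewrite -esumZl//.
apply: le_esum => k _; rewrite -EFinM lee_fin.
apply: (@le_trans _ _ (C / m * (L (z - t k) * psi `|c k - b k|))).
  by apply: ler_pM.
by rewrite le_eqVlt; apply/orP; left; apply/eqP; ring.
Qed.

Lemma kernel_sum_modular_unif (chi : R -> R -> R) (L psi phi eta : R -> R) (t : int -> R)
    (m C lam kappa z : R) (c b : int -> R) (K : \bar R) :
  chi3 chi L psi ->
  phi_function phi -> convex_on_nonneg phi ->
  (zesum (fun k => L (z - t k)%R) <= m%:E)%E -> 0 < m -> 0 < C ->
  (forall u, 0 <= u -> phi (C * psi u) <= eta (lam * u)) ->
  0 <= kappa -> kappa * m <= C ->
  zsummable (fun k => chi (z - t k) (c k)) ->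
  zsummable (fun k => chi (z - t k) (b k)) ->
  (0 <= K)%E -> (forall k, ((eta (lam * `|c k - b k|))%:E <= K)%E) ->
  ((phi (kappa * `|zsum (fun k => chi (z - t k) (c k)) -
                   zsum (fun k => chi (z - t k) (b k))|))%:E <= K)%E.
Proof.
move=> c3 phiP phiC Lm m_gt0 C0 H k0 km sc sb.
case: K => [r|_ _|]; [|by rewrite leey|by []].
rewrite lee_fin => r0 eK; have L0 := c3.2.1.
apply: (le_trans (kernel_sum_modular c3 phiP phiC Lm m_gt0 C0 H k0 km sc sb)).
(* With a bound [r] free of [k], the weights sum to at most [m] and cancel the factor [m^-1]. *)
apply: (@le_trans _ _ (m^-1%:E * (r%:E * m%:E))%E); last first.
  by rewrite -!EFinM mulrCA mulVf ?mulr1// gt_eqF.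
apply: lee_wpmul2l; first by rewrite lee_fin invr_ge0 ltW.
apply: (@le_trans _ _ (\esum_(k in [set: int]) (r%:E * (L (z - t k))%:E))%E).
  by apply: le_esum => k _; rewrite -EFinM lee_fin mulrC ler_wpM2r// -lee_fin.
rewrite esumZl//; last by move=> k; rewrite lee_fin; exact: L0.
by apply: lee_wpmul2l; [rewrite lee_fin|exact: Lm].
Qed.

Lemma chi4_dist (chi : R -> R -> R) (t : int -> R) (z u e : R) : chi2 chi ->
  (u != 0 -> `|u^-1 * zsum (fun k => chi (z - t k) u) - 1| <= e) -> 0 <= e ->
  `|zsum (fun k => chi (z - t k) u) - u| <= e * `|u|.
Proof.
move=> c2 H e0; have [->|u0] := eqVneq u 0.
  have -> : (fun k => chi (z - t k) 0) = (fun=> 0) by apply/funext => k; exact: c2.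
  by rewrite zsum0 subr0 normr0 mulr0.
have -> : zsum (fun k => chi (z - t k) u) - u =
    u * (u^-1 * zsum (fun k => chi (z - t k) u) - 1).
  by rewrite mulrBr mulVKf// mulr1.
by rewrite normrM mulrC ler_wpM2r// H.
Qed.

End kernel_estimates.

(** * Translates of [f], the modulus of smoothness and the tail of the kernel *)

Section modulus_estimates.
Context {R : realType}.
Local Notation leb := (@lebesgue_measure R).
Variables (eta f : R -> R) (lam : R).
Hypothesis eta_phi : phi_function eta.
Hypothesis mf : measurable_fun setT f.

(** Its integral in [u] is the modular of [lam * (f (. + y) - f)]; both orders of the variables get
    a joint measurability proof, since Tonelli is used in both. *)
Let F (y u : R) : \bar R := (eta `|lam * (f (u + y) - f u)|)%:E.

Let eta0 (u : R) : 0 <= eta `|u|.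
Proof. by have [_ em e0 _ _] := eta_phi; exact: nonneg_of_mono. Qed.

Let eta_ge0 (u : R) : (0 <= (eta `|u|)%:E)%E. Proof. by rewrite lee_fin. Qed.

Let F0 y u : (0 <= F y u)%E. Proof. by rewrite lee_fin. Qed.

Lemma measurable_eta_comp d (T : measurableType d) (g : T -> R) :
  measurable_fun setT g -> measurable_fun setT (fun x => (eta `|g x|)%:E).
Proof.
have [_ em _ _ _] := eta_phi.
by move=> mg; apply/measurable_EFinP; exact: (measurableT_comp (measurable_comp_norm em) mg).
Qed.

Let mF2 : measurable_fun setT (fun p : measurableTypeR R * measurableTypeR R => F p.1 p.2).
Proof.
apply: measurable_eta_comp; apply: measurable_funM => //; apply: measurable_funB.
  by apply: (measurableT_comp mf); exact: measurable_funD.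
exact: measurableT_comp.
Qed.

Let mF2s : measurable_fun setT (fun p : measurableTypeR R * measurableTypeR R => F p.2 p.1).
Proof.
apply: measurable_eta_comp; apply: measurable_funM => //; apply: measurable_funB.
  by apply: (measurableT_comp mf); exact: measurable_funD.
exact: measurableT_comp.
Qed.

Let mF y : measurable_fun setT (F y).
Proof.
apply: measurable_eta_comp; apply: measurable_funM => //; apply: measurable_funB => //.
by apply: (measurableT_comp mf); exact: measurable_funD.
Qed.

Lemma modular_translate_le_omega y d : `|y| <= d ->
  (modular eta (fun x => (lam * (f (x + y) - f x))%R) <= omega eta lam f d)%E.
Proof. by move=> yd; apply: ereal_sup_ubound; exists y. Qed.

Lemma omega_ge0 d : 0 <= d -> (0 <= omega eta lam f d)%E.
Proof.
move=> d0; apply: (@le_trans _ _ (modular eta (fun x => (lam * (f (x + 0) - f x))%R))).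
  by apply: integral_ge0 => x _; rewrite lee_fin.
by apply: modular_translate_le_omega; rewrite normr0.
Qed.

(** Convexity at the midpoint splits the difference into two halves with doubled arguments, whence
    [2 * lam <= lam0]; translation invariance makes both halves equal. *)
Lemma modular_translate_le (lam0 y : R) : convex_on_nonneg eta ->
  0 <= lam -> 2 * lam <= lam0 ->
  (modular eta (fun x => (lam * (f (x + y) - f x))%R) <=
   modular eta (fun x => (lam0 * f x)%R))%E.
Proof.
move=> econv l0 ll; have [_ em e0 _ _] := eta_phi.
have l00 : 0 <= lam0 by lra.
pose g x := (eta `|lam0 * f x|)%:E.
have mg : measurable_fun setT g by apply: measurable_eta_comp; exact: measurable_funM.
have g0 x : (0 <= g x)%E by rewrite lee_fin.
have mgy : measurable_fun setT (fun x : R => g (x + y)).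
  by apply: (measurableT_comp mg); exact: measurable_funD.
apply: (@le_trans _ _ (\int[leb]_x (2^-1%:E * (g (x + y)%R + g x)))%E).
  apply: ge0_le_integral_nonmeasurable => x; first by rewrite lee_fin.
  rewrite -EFinD -EFinM lee_fin.
  apply: (@le_trans _ _ (eta (lam * `|f (x + y)| + lam * `|f x|))).
    apply: em => //; rewrite normrM (ger0_norm l0) -mulrDr ler_wpM2l//.
    by rewrite -(normrN (f x)) ler_normD.
  apply: (le_trans (convex_half econv _ _)); rewrite ?mulr_ge0//.
  rewrite mulrC ler_wpM2l ?invr_ge0// !normrM (ger0_norm l00).
  by apply: lerD; apply: em; rewrite ?mulr_ge0// mulrA ler_wpM2r.
rewrite ge0_integralZl_EFin//; last 2 first.
- by move=> x _; exact: adde_ge0.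
- exact: emeasurable_funD.
rewrite ge0_integralD// ge0_integral_shiftT//.
by rewrite -mule2n -mule_natl muleA -EFinM mulVf ?pnatr_eq0// mul1e.
Qed.

(** After Tonelli the inner integral is the modular for a shift [v] in [0, H], at most the modulus
    at [H]; integrating in [v] yields the factor [H]. *)
Lemma modular_average_le (h H : R) : 0 <= h -> 0 <= H ->
  (\int[leb]_x (h^-1%:E * \int[leb]_(v in `[0%R, H]) (eta `|lam * (f (x + v) - f x)|)%:E)
   <= (h^-1 * H)%:E * omega eta lam f H)%E.
Proof.
move=> h0 H0.
rewrite ge0_integralZl_EFin ?invr_ge0//; last 2 first.
- by move=> x _; apply: integral_ge0 => ? _; exact: eta_ge0.
- exact: (@measurable_section_integral _ (fun x v => F v x)).
rewrite EFinM -muleA; apply: lee_wpmul2l; first by rewrite lee_fin invr_ge0.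
rewrite (@integral_section_swap _ (fun x v => F v x))//.
apply: (@le_trans _ _ (\int[leb]_(v in `[0%R, H]) omega eta lam f H)%E).
  apply: ge0_le_integral => //.
  - by move=> v _; apply: integral_ge0 => ? _; exact: eta_ge0.
  - apply: (@measurable_funS _ _ _ _ setT) => //.
    exact: (@measurable_section_integral _ F).
  - move=> v /=; rewrite in_itv/= => /andP[v0 vH].
    by apply: modular_translate_le_omega; rewrite ger0_norm.
rewrite integral_cst//= lebesgue_measure_itv/= lte_fin.
case: ifP => [_|/negbT]; first by rewrite sube0 muleC.
by rewrite -leNgt mule0 => _; rewrite mule_ge0// omega_ge0.
Qed.

Lemma kernel_tail_split (L : R -> R) (w d M : R) (I : \bar R) :
  L1cond L -> (forall x, 0 <= L x) -> 0 < w -> 0 <= d -> (0 <= I)%E ->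
  (forall y, (modular eta (fun x => (lam * (f (x + y) - f x))%R) <= I)%E) ->
  (w%:E * \int[leb]_(y in [set y : R | (d < `|y|)%R]) (L (w * y)%R)%:E <= M%:E)%E ->
  (w%:E * \int[leb]_y ((L (w * y)%R)%:E * \int[leb]_u F y u) <=
   (L1norm L)%:E * omega eta lam f d + M%:E * I)%E.
Proof.
move=> [Lint _] L0 w0 d0 I0 FI tail; have w0' := ltW w0.
have mL : measurable_fun setT (EFin \o L) by case/integrableP: Lint.
have mLw : measurable_fun setT (fun y => (L (w * y))%:E).
  by apply: (measurableT_comp mL); exact: measurable_funM.
pose A := [set y : R | d < `|y|].
have mA : measurable A.
  have -> : A = [set: R] `&` (fun y : R => `|y|) @^-1` `]d, +oo[%classic.
    by rewrite setTI; apply/seteqP; split => y /=; rewrite in_itv/= andbT.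
  have mn : measurable_fun setT (fun y : R => `|y|) by exact: measurableT_comp.
  exact: mn.
pose g := (fun y => (L (w * y)%R)%:E : \bar R) \_ A.
have g0 y : (0 <= g y)%E by rewrite /g patchE; case: ifP => // _; rewrite lee_fin.
have mg : measurable_fun setT g.
  by apply/(measurable_restrictT _ mA); exact: measurable_funS mLw.
(* The [omega] term is kept for every [y], not only for [|y| <= d]: rescaling then turns its
   coefficient into exactly the norm of [L]. Only [g], supported on the tail, multiplies [I]. *)
apply: (@le_trans _ _ (w%:E * \int[leb]_y ((L (w * y)%R)%:E * omega eta lam f d + g y * I))%E).
  apply: lee_wpmul2l; first by rewrite lee_fin.
  apply: ge0_le_integral_nonmeasurable => y.
    by apply: mule_ge0; [rewrite lee_fin|apply: integral_ge0 => ? _; exact: eta_ge0].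
  case: (leP `|y| d) => yd.
    rewrite -[leLHS]adde0; apply: leeD; last exact: mule_ge0.
    by apply: lee_wpmul2l; [rewrite lee_fin|exact: modular_translate_le_omega].
  rewrite -[leLHS]add0e; apply: leeD.
    by rewrite mule_ge0 ?lee_fin ?omega_ge0.
  rewrite /g patchE ifT; last by rewrite inE.
  by apply: lee_wpmul2l; [rewrite lee_fin|exact: FI].
have om0 := omega_ge0 d0.
rewrite ge0_integralD//; last 4 first.
- by move=> y _; rewrite mule_ge0 ?lee_fin.
- by apply: emeasurable_funM.
- by move=> y _; rewrite mule_ge0.
- by apply: emeasurable_funM.
rewrite ge0_integralZr//; last by move=> y _; rewrite lee_fin.
rewrite ge0_integralZr//.
rewrite ge0_muleDr; last 2 first.
- by rewrite mule_ge0//; apply: integral_ge0 => y _; rewrite lee_fin.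
- by rewrite mule_ge0//; apply: integral_ge0.
rewrite !muleA; apply: leeD; last first.
  by apply: lee_wpmul2r => //; rewrite -integral_mkcond.
rewrite (@ge0_integral_scale _ (EFin \o L))//.
rewrite /L1norm /Rintegral fineK.
  by under [X in (_ <= X * _)%E]eq_integral do rewrite ger0_norm//.
under eq_integral do rewrite ger0_norm//.
exact: (integrable_fin_num _ Lint).
Qed.

Lemma measurable_average (h H : R) :
  measurable_fun setT (fun x : R => h^-1%:E *
    \int[leb]_(v in `[0%R, H]) (eta `|lam * (f (x + v) - f x)|)%:E)%E.
Proof.
apply: measurable_funeM.
exact: (@measurable_section_integral _ (fun x v => F v x)).
Qed.

Lemma measurable_kernel_term (L : R -> R) (w a b h : R) : measurable_fun setT L ->
  measurable_fun setT (fun x : R => (L (w * x - b)%R)%:E * (h^-1%:E *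
    \int[leb]_(v in `[0%R, h]) (eta `|lam * (f (x + v) - f (a + v))|)%:E))%E.
Proof.
move=> mL; apply: emeasurable_funM.
  apply/measurable_EFinP; apply: (measurableT_comp mL).
  by apply: measurable_funB => //; exact: measurable_funM.
apply: measurable_funeM.
apply: (@measurable_section_integral _ (fun x v => (eta `|lam * (f (x + v) - f (a + v))|)%:E)) => //.
apply: measurable_eta_comp; apply: measurable_funM => //; apply: measurable_funB.
  by apply: (measurableT_comp mf); exact: measurable_funD.
by apply: (measurableT_comp mf); apply: measurable_funD.
Qed.

(** Finiteness allows the final comparison to be carried out among real numbers. *)
Lemma omega_fin_num (lam0 d : R) : convex_on_nonneg eta -> 0 <= d ->
  0 <= lam -> 2 * lam <= lam0 -> (modular eta (fun x => (lam0 * f x)%R) < +oo)%E ->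
  omega eta lam f d \is a fin_num.
Proof.
move=> ec d0 l0 ll fin; rewrite ge0_fin_numE ?omega_ge0//; apply: le_lt_trans fin.
by apply: ge_ereal_sup => _ [y _ <-]; exact: modular_translate_le.
Qed.

(** Serves both comparisons of means: with [g2] a translate of [f] for S_w f - P, and with [g2]
    constant for P - Q. *)
Lemma eta_mean_dist (g1 g2 : R -> R) (h : R) : convex_on_nonneg eta ->
  0 < h -> 0 <= lam -> measurable_fun setT g1 -> measurable_fun setT g2 ->
  leb.-integrable `[0, h] (EFin \o g1) -> leb.-integrable `[0, h] (EFin \o g2) ->
  ((eta (lam * `|h^-1 * Rintegral leb `[0, h] g1 - h^-1 * Rintegral leb `[0, h] g2|))%:E
   <= h^-1%:E * \int[leb]_(v in `[0%R, h]) (eta `|lam * (g1 v - g2 v)|)%:E)%E.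
Proof.
move=> ec h0 l0 mg1 mg2 i1 i2; have [_ em e0 _ _] := eta_phi.
have mg : measurable_fun setT (fun v => `|g1 v - g2 v|).
  by apply: measurableT_comp => //; exact: measurable_funB.
refine (@jensen_integral R eta em e0 ec _ _ leb `[0, h]%classic (fun v => `|lam * (g1 v - g2 v)|) h _ _ _ _ _ _ _ _) => //.
- by rewrite [LHS]lebesgue_measure_itv/= lte_fin h0 sube0.
- apply: (@measurable_funS _ _ _ _ setT) => //; apply: measurableT_comp => //.
  by apply: measurable_funM => //; exact: measurable_funB.
- by rewrite mulr_ge0.
rewrite EFinM; apply: (@le_trans _ _ (lam%:E * (h^-1%:E *
    \int[leb]_(v in `[0%R, h]) (`|g1 v - g2 v|)%:E))%E).
  by apply: lee_wpmul2l; [rewrite lee_fin|exact: avg_dist].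
rewrite muleCA; apply: lee_wpmul2l; first by rewrite lee_fin invr_ge0 ltW.
rewrite -ge0_integralZl_EFin//; last first.
  by apply: (@measurable_funS _ _ _ _ setT) => //; exact/measurable_EFinP.
rewrite le_eqVlt; apply/orP; left; apply/eqP; apply: eq_integral => v _.
by rewrite normrM (ger0_norm l0).
Qed.

Lemma kernel_average_le (L : R -> R) (t : int -> R) (delta Delta w m : R) :
  sampling_seq t delta Delta -> measurable_fun setT L -> (forall x, 0 <= L x) ->
  0 < w -> 0 < m ->
  (\int[leb]_x (m^-1%:E * \esum_(k in [set: int])
      ((L (w * x - t k)%R)%:E * ((Dk t k / w)^-1%:E *
        \int[leb]_(v in `[0%R, (Dk t k / w)%R])
           (eta `|lam * (f (x + v) - f (t k / w + v))|)%:E)))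
   <= (m^-1 / delta)%:E * (w%:E *
        \int[leb]_y ((L (w * y)%R)%:E * \int[leb]_u F y u)))%E.
Proof.
move=> [[d0 _] tmono tk _ _] mL L0 w0 m_gt0.
have mi0 : 0 <= m^-1 by rewrite invr_ge0 ltW.
have wi0 : 0 < w^-1 by rewrite invr_gt0.
pose h k := Dk t k / w.
have hk k : delta / w <= h k.
  by rewrite /h ler_wpM2r ?(ltW wi0)//; have /andP[] := tk k.
have dw : 0 < delta / w by rewrite divr_gt0.
have h0 k : 0 < h k by exact: lt_le_trans (hk k).
have hi k : (h k)^-1 <= w / delta.
  by rewrite -(invf_div delta w) lef_pV2 ?posrE.
have hi0 k : 0 <= (h k)^-1 by rewrite invr_ge0 ltW.
pose E k x : \bar R := ((L (w * x - t k)%R)%:E * ((h k)^-1%:E *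
        \int[leb]_(v in `[0%R, (h k)])
           (eta `|lam * (f (x + v) - f (t k / w + v))|)%:E))%E.
have E0 k x : (0 <= E k x)%E.
  by rewrite /E !mule_ge0 ?lee_fin//; apply: integral_ge0 => ? _; exact: eta_ge0.
have mE k : measurable_fun setT (E k) by exact: measurable_kernel_term.
pose W y := w / delta * L (w * y).
have W0 y : 0 <= W y by rewrite mulr_ge0// divr_ge0 // ?(ltW w0) ?(ltW d0).
have mW : measurable_fun setT (fun y => (W y)%:E).
  apply/measurable_EFinP; apply: measurable_funM => //.
  by apply: (measurableT_comp mL); exact: measurable_funM.
pose P k y := (\int[leb]_(u in `[(t k / w)%R, (t (k + 1) / w)%R]) F y u)%E.
have P0 k y : (0 <= P k y)%E by apply: integral_ge0 => ? _; exact: eta_ge0.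
have mP k : measurable_fun setT (P k) by exact: (@measurable_section_integral _ F).
rewrite ge0_integralZl_EFin//; last 2 first.
- by move=> x _; apply: esum_ge0 => k _; exact: E0.
- exact: measurable_esum_int.
rewrite EFinM -muleA; apply: lee_wpmul2l; first by rewrite lee_fin.
rewrite integral_esum_int//.
apply: (@le_trans _ _ (\esum_(k in [set: int]) \int[leb]_y ((W y)%:E * P k y))%E).
  (* Substituting [x = y + t k / w] makes the kernel [L (w * y)] for every [k]; the point
     [u = t k / w + v] runs through the k-th cell, so [k] remains only in the domain of [P k y] and
     the cells can be added up. *)
  apply: le_esum => k _; rewrite -(@ge0_integral_shiftT _ (E k) (t k / w))//.
  apply: ge0_le_integral_nonmeasurable => y //.
  have -> : P k y = (\int[leb]_(v in `[0%R, h k])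
      (eta `|lam * (f (y + t k / w + v) - f (t k / w + v))|)%:E)%E.
    rewrite /P (_ : t (k + 1) / w = t k / w + h k); last first.
      by rewrite /h /Dk -mulrDl [t k + _]addrC subrK.
    rewrite -ge0_integral_shift_itv//; apply: eq_integral => v _.
    by rewrite /F [_ + v + y]addrC addrA.
  rewrite /E (_ : w * (y + t k / w) - t k = w * y); last first.
    by rewrite mulrDr mulrCA mulfV ?gt_eqF// mulr1 addrK.
  rewrite muleA; apply: lee_wpmul2r; first by apply: integral_ge0 => ? _; exact: eta_ge0.
  by rewrite -EFinM lee_fin /W mulrC ler_wpM2r.
rewrite -integral_esum_int//; last 2 first.
- by move=> k y; apply: mule_ge0; [rewrite lee_fin; exact: W0|exact: P0].
- by move=> k; apply: emeasurable_funM; [exact: mW|exact: mP].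
apply: (@le_trans _ _ (\int[leb]_y ((W y)%:E * \int[leb]_u F y u))%E).
  apply: ge0_le_integral_nonmeasurable => y.
    by apply: esum_ge0 => k _; apply: mule_ge0; [rewrite lee_fin; exact: W0|exact: P0].
  rewrite esumZl//; apply: lee_wpmul2l; first by rewrite lee_fin.
  apply: (@esum_integral_itv_le _ (fun k => t k / w)) => // k.
  by rewrite ler_wpM2r ?(ltW wi0)// ltW.
rewrite muleA -EFinM mulrC -ge0_integralZl_EFin//.
- by rewrite le_eqVlt; apply/orP; left; apply/eqP; apply: eq_integral => y _; rewrite /W EFinM muleA.
- by move=> y _; apply: mule_ge0; [rewrite lee_fin|apply: integral_ge0 => ? _; exact: eta_ge0].
- apply: emeasurable_funM; last exact: (@measurable_section_integral _ F).
  apply/measurable_EFinP; apply: (measurableT_comp mL); exact: measurable_funM.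
- by rewrite divr_ge0 // ?(ltW w0) ?(ltW d0).
Qed.

End modulus_estimates.

(** * Choice of the constants and assembly of the three estimates *)

Theorem theorem3p1 (R : realType) (t : int -> R) (delta Delta : R)
    (chi : R -> R -> R) (L psi : R -> R) (theta0 : R)
    (phi eta : R -> R) (f : R -> R) (alpha M1 alpha0 : R) :
  sampling_seq t delta Delta ->
  chi1 chi t -> chi2 chi -> chi3 chi L psi -> chi4 chi t theta0 ->
  (forall u : R, measurable_fun [set: R] (fun x => chi x u)) ->
  L1cond L -> L2cond L t ->
  phi_function phi -> convex_on_nonneg phi ->
  phi_function eta -> convex_on_nonneg eta -> condH phi psi eta ->
  orlicz (fun u => phi u + eta u) f ->
  0 < alpha < 1 -> 0 < M1 -> 0 < alpha0 ->
  (exists W : R, forall w : R, W < w ->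
     (w%:E * \int[@lebesgue_measure R]_(y in [set y : R | (w `^ (- alpha) < `|y|)%R])
                (L (w * y)%R)%:E <= (M1 * w `^ (- alpha0))%:E)%E) ->
  exists mu lam0 lam : R, [/\ 0 < mu /\ 0 < lam0 /\ 0 < lam,
    (modular phi (fun x => (lam0 * f x)%R) < +oo)%E,
    (modular eta (fun x => (lam0 * f x)%R) < +oo)%E &
    exists W : R, forall w : R, W < w ->
      (modular phi (fun x => (mu * (kantorovich chi t w f x - f x))%R)
       <= (L1norm L / (3 * delta * m0 L t))%:E * omega eta lam f (w `^ (- alpha))
        + (M1 / (3 * delta * m0 L t))%:E * modular eta (fun x => (lam0 * f x)%R)
            * (w `^ (- alpha0))%:E
        + (Delta / (3 * delta))%:E * omega eta lam f (Delta / w)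
        + modular phi (fun x => (lam0 * f x)%R) * (w `^ (- theta0) / 3)%:E)%E].
Proof.
move=> hS c1 c2 c3 [th0 [C0 [W0 [W00 c4]]]] _ hL1 hL2 phiP phiC etaP etaC hH.
move=> [mf [l [l0 lfin]]] al M10 a00 [W1 htail].
pose leb := @lebesgue_measure R.
have [[d0 dD] tmono tk _ _] := hS.
have L0 := c3.2.1; have mL := c3.1.
have [_ fmono f0 _ _] := phiP.
have [_ emono e0 _ _] := etaP.
have phi0 u : 0 <= u -> 0 <= phi u by exact: nonneg_of_mono.
have eta0 u : 0 <= u -> 0 <= eta u by exact: nonneg_of_mono.
(* Both modulars are dominated by that of [phi + eta], so the single [l] serves as [lam0] for
   each. *)
have phifin : (modular phi (fun x => (l * f x)%R) < +oo)%E.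
  apply: le_lt_trans lfin; apply: ge0_le_integral_nonmeasurable => x; rewrite lee_fin ?phi0//.
  by rewrite lerDl eta0.
have etafin : (modular eta (fun x => (l * f x)%R) < +oo)%E.
  apply: le_lt_trans lfin; apply: ge0_le_integral_nonmeasurable => x; rewrite lee_fin ?eta0//.
  by rewrite lerDr phi0.
have Lm := zesum_le_m0 L0 (zesum_kernel_bound hS L0 hL1 hL2).
have m_gt0 : 0 < m0 L t.
  by apply: (m0_gt0 c2 c3 _ Lm); split; [exact: th0|exists C0, W0].
set m := m0 L t in Lm m_gt0 *.
(* Condition (H) asks for [lam < 1], and comparing a translate with the modular of [l * f] asks for
   [2 * lam <= l]. *)
pose lam := Num.min (l / 2) 2^-1.
have lam0 : 0 < lam by rewrite /lam lt_min; lra.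
have lam1 : lam < 1 by rewrite /lam gt_min; lra.
have lam2 : 2 * lam <= l.
  have : lam <= l / 2 by rewrite /lam ge_min lexx.
  by lra.
have laml := ltW lam0.
have [Ch [/andP[Ch0 _] hCh]] : exists C : R, 0 < C < 1 /\
    forall u : R, 0 <= u -> phi (C * psi u) <= eta (lam * u).
  by apply: hH; rewrite lam0.
(* The constant of (chi4) carries no sign; this makes it positive so that [l / C1] is a valid
   bound. *)
pose C1 := Num.max C0 1.
have C10 : 0 < C1 by rewrite /C1 lt_max ltr01 orbT.
(* The first entry serves the two Jensen steps, the second keeps Q - f below a multiple of
   [l * f]. *)
pose kappa := Num.min (Ch / m) (l / C1).
have k0 : 0 < kappa by rewrite /kappa lt_min !divr_gt0.
have km : kappa * m <= Ch by rewrite -ler_pdivlMr// /kappa ge_min lexx.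
have kC : kappa * C1 <= l by rewrite -ler_pdivlMr// /kappa ge_min lexx orbT.
have kge0 := ltW k0.
(* [convex_third] multiplies each of the three arguments by 3, which restores [kappa]. *)
exists (kappa / 3), l, lam; split => //; first by do !split => //; lra.
(* [W0] and [W1] are the thresholds of (chi4) and of the tail bound; 1 ensures
   [w ^ (- theta0) <= 1]. *)
exists (Num.max (Num.max W0 W1) 1) => w.
rewrite !gt_max => /andP[/andP[W0w W1w] w1].
have w0 : 0 < w by lra.
pose d := w `^ (- alpha); have dd0 : 0 <= d by exact: powR_ge0.
pose H := Delta / w.
have H0 : 0 <= H by rewrite divr_ge0 ?(ltW w0)//; lra.
pose e := w `^ (- theta0).
have ee0 : 0 <= e by exact: powR_ge0.
have e1 : e <= 1.
  rewrite /e powRN invf_le1 ?powR_gt0// -(powRr0 w).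
  by apply: ler_powR; lra.
pose h k := Dk t k / w.
pose h0 := delta / w.
have h00 : 0 < h0 by rewrite divr_gt0.
have hb k : h0 <= h k <= H.
  have /andP[h1 h2] := tk k.
  by rewrite /h0 /h /H !ler_wpM2r// invr_ge0 ltW.
have hpos k : 0 < h k by have := hb k; lra.
have h0H : h0 <= H by have := hb 0; lra.
have [B HB] := avg_bound etaP etaC mf l0 etafin h00 h0H.
pose avg k a := (h k)^-1 * Rintegral leb `[0, h k] (fun v => f (a + v)).
have avgB k a : `|avg k a| <= B by exact: HB.
have mfs a : measurable_fun setT (fun v : R => f (a + v)).
  by apply: (measurableT_comp mf); exact: measurable_funD.
have ifs k a : leb.-integrable `[0, h k] (EFin \o (fun v => f (a + v))).
  by apply: (integrable_translate etaP etaC mf l0 etafin); exact: ltW.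
pose P x := zsum (fun k => chi (w * x - t k) (avg k x)).
pose Q x := zsum (fun k => chi (w * x - t k) (f x)).
(* S_w f and P now use the same operator [avg k], based at the node for one and at [x] for the
   other. *)
have Sx x : kantorovich chi t w f x =
    zsum (fun k => chi (w * x - t k) (avg k (t k / w))).
  rewrite /kantorovich; congr zsum; apply/funext => k; congr chi.
  rewrite /avg (Rintegral_shift_itv _ _ mf) /h invf_div (_ : t k / w + Dk t k / w = t (k + 1) / w)//.
  by rewrite /Dk -mulrDl [t k + _]addrC subrK.
pose G1 x : \bar R := (m^-1%:E * \esum_(k in [set: int])
      ((L (w * x - t k)%R)%:E * ((Dk t k / w)^-1%:E *
        \int[leb]_(v in `[0%R, (Dk t k / w)%R])
           (eta `|lam * (f (x + v) - f (t k / w + v))|)%:E)))%E.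
pose G2 x : \bar R :=
  (h0^-1%:E * \int[leb]_(v in `[0%R, H]) (eta `|lam * (f (x + v) - f x)|)%:E)%E.
pose G3 x : \bar R := (e%:E * (phi `|l * f x|)%:E)%E.
have i0 (D : set R) (g : R -> R) : (0 <= \int[leb]_(v in D) (eta `|g v|)%:E)%E.
  by apply: integral_ge0 => v _; rewrite lee_fin eta0.
have T0 k x : (0 <= (L (w * x - t k)%R)%:E * ((Dk t k / w)^-1%:E *
        \int[leb]_(v in `[0%R, (Dk t k / w)%R])
           (eta `|lam * (f (x + v) - f (t k / w + v))|)%:E))%E.
  rewrite mule_ge0 ?lee_fin ?L0// mule_ge0 ?i0// lee_fin invr_ge0.
  exact: ltW (hpos k).
have G10 x : (0 <= G1 x)%E.
  by rewrite mule_ge0 ?lee_fin ?invr_ge0 ?(ltW m_gt0)//; apply: esum_ge0.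
have G20 x : (0 <= G2 x)%E.
  by rewrite mule_ge0 ?i0// lee_fin invr_ge0 ltW.
have G30 x : (0 <= G3 x)%E by rewrite mule_ge0 ?lee_fin// phi0.
have mG1 : measurable_fun setT G1.
  apply: measurable_funeM; apply: measurable_esum_int => // k.
  exact: (measurable_kernel_term lam etaP mf w (t k / w) (t k) (h k) mL).
have mG2 : measurable_fun setT G2 by exact: (measurable_average lam etaP mf).
have mG3 : measurable_fun setT G3.
  apply: measurable_funeM; apply: (measurable_eta_comp phiP).
  exact: measurable_funM.
have sS x : zsummable (fun k => chi (w * x - t k) (avg k (t k / w))).
  by apply: (kernel_summable (B := B) c2 c3 (Lm _)).
have sP x : zsummable (fun k => chi (w * x - t k) (avg k x)).
  by apply: (kernel_summable (B := B) c2 c3 (Lm _)).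
have sQ x : zsummable (fun k => chi (w * x - t k) (f x)).
  by apply: (kernel_summable (B := `|f x|) c2 c3 (Lm _)).
have J1 x : ((phi (kappa * `|kantorovich chi t w f x - P x|))%:E <= G1 x)%E.
  rewrite Sx; apply: (le_trans (kernel_sum_modular c3 phiP phiC (Lm _) m_gt0 Ch0 hCh kge0 km (sS x) (sP x))).
  apply: lee_wpmul2l; first by rewrite lee_fin invr_ge0 ltW.
  apply: le_esum => k _; rewrite EFinM; apply: lee_wpmul2l; first by rewrite lee_fin.
  by rewrite distrC; exact: (eta_mean_dist etaP etaC).
have J2 x : ((phi (kappa * `|P x - Q x|))%:E <= G2 x)%E.
  apply: (kernel_sum_modular_unif c3 phiP phiC (Lm _) m_gt0 Ch0 hCh kge0 km) => // k.
  rewrite -[f x in X in (eta X)%:E](mean_cst (f x) (hpos k)).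
  have icst : leb.-integrable `[0, h k] (EFin \o (fun=> f x)).
    apply/integrableP; split; first exact: measurable_cst.
    by rewrite integral_cst//= lebesgue_measure_itv/= lte_fin hpos -EFinB -EFinM ltry.
  apply: (le_trans (eta_mean_dist etaP etaC (hpos k) laml (mfs x) _ (ifs k x) icst)) => //.
  have /andP[hk1 hk2] := hb k.
  (* Passing to the common factor [h0^-1] and the common interval [0, H] removes [k], as the uniform
     version requires. *)
  apply: lee_pmul.
  - by rewrite lee_fin invr_ge0 ltW.
  - exact: i0.
  - by rewrite lee_fin lef_pV2 ?posrE.
  apply: ge0_subset_integral => //.
  - apply: (@measurable_funS _ _ _ _ setT) => //; apply: (measurable_eta_comp etaP).
    by apply: measurable_funM => //; apply: measurable_funB; [exact: mfs|exact: measurable_cst].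
  - by move=> v _; rewrite lee_fin eta0.
  - by apply: subset_itvl; rewrite bnd_simp.
have J3 x : ((phi (kappa * `|Q x - f x|))%:E <= G3 x)%E.
  rewrite /G3 -EFinM lee_fin.
  (* Since [e <= 1], convexity with [phi 0 = 0] pulls [e] out of [phi]; this is where
     [w ^ (- theta0)] enters. *)
  apply: (@le_trans _ _ (phi (e * `|l * f x|))); last first.
    by apply: (convex_star f0 phiC) => //; rewrite ee0.
  apply: fmono; first by rewrite mulr_ge0.
  have qf : `|Q x - f x| <= (C1 * e) * `|f x|.
    apply: chi4_dist => //; last by rewrite mulr_ge0// ltW.
    move=> fx0; apply: (le_trans (c4 w x (f x) W0w fx0)).
    by rewrite ler_wpM2r// /C1 le_max lexx.
  apply: (@le_trans _ _ (kappa * (C1 * e * `|f x|))); first by rewrite ler_wpM2l.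
  rewrite normrM (gtr0_norm l0).
  have -> : kappa * (C1 * e * `|f x|) = e * (kappa * C1 * `|f x|) by ring.
  by rewrite ler_wpM2l// ler_wpM2r.
have pt x : ((phi `|kappa / 3 * (kantorovich chi t w f x - f x)|)%:E <=
    3^-1%:E * (G1 x + G2 x + G3 x))%E.
  apply: (@le_trans _ _ (3^-1 * (phi (kappa * `|kantorovich chi t w f x - P x|) +
     phi (kappa * `|P x - Q x|) + phi (kappa * `|Q x - f x|)))%:E).
    rewrite lee_fin [leRHS]mulrC.
    set a := `|_ - P x|; set b := `|P x - _|; set c := `|Q x - _|.
    have k3 : 0 <= kappa / 3 by rewrite divr_ge0.
    have ha : 0 <= kappa / 3 * a by apply: mulr_ge0 => //; exact: normr_ge0.
    have hbb : 0 <= kappa / 3 * b by apply: mulr_ge0 => //; exact: normr_ge0.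
    have hc : 0 <= kappa / 3 * c by apply: mulr_ge0 => //; exact: normr_ge0.
    have := convex_third phiC ha hbb hc.
    have e3 (y : R) : 3 * (kappa / 3 * y) = kappa * y by field.
    rewrite !e3; apply: le_trans; apply: fmono => //.
    rewrite normrM (ger0_norm k3) -!mulrDr ler_wpM2l//.
    rewrite (_ : _ - f x = (kantorovich chi t w f x - P x) + (P x - Q x) + (Q x - f x)).
      by apply: (le_trans (ler_normD _ _)); rewrite lerD2r ler_normD.
    by ring.
  rewrite EFinM; apply: lee_wpmul2l; first by rewrite lee_fin.
  by rewrite !EFinD !leeD.
have om1 := omega_fin_num etaP mf etaC dd0 laml lam2 etafin.
have om2 := omega_fin_num etaP mf etaC H0 laml lam2 etafin.
have Iphi : modular phi (fun x => l * f x) \is a fin_num.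
  by rewrite ge0_fin_numE//; apply: integral_ge0 => x _; rewrite lee_fin phi0.
have Ieta0 : (0 <= modular eta (fun x => (l * f x)%R))%E.
  by apply: integral_ge0 => x _; rewrite lee_fin eta0.
have Ieta : modular eta (fun x => l * f x) \is a fin_num by rewrite ge0_fin_numE.
apply: (@le_trans _ _ (\int[leb]_x (3^-1%:E * (G1 x + G2 x + G3 x)))%E).
  by apply: ge0_le_integral_nonmeasurable => // x; rewrite lee_fin phi0.
rewrite ge0_integralZl_EFin//; last 2 first.
- by move=> x _; rewrite !adde_ge0.
- by apply: emeasurable_funD => //; exact: emeasurable_funD.
rewrite ge0_integralD//; last 2 first.
- by move=> x _; rewrite adde_ge0.
- exact: emeasurable_funD.
rewrite ge0_integralD//.
have I1 : (\int[leb]_x G1 x <= (m^-1 / delta)%:E *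
   ((L1norm L)%:E * omega eta lam f d + (M1 * w `^ (- alpha0))%:E * modular eta (fun x => (l * f x)%R)))%E.
  apply: (le_trans (kernel_average_le lam etaP mf hS mL L0 w0 m_gt0)).
  apply: lee_wpmul2l; first by rewrite lee_fin !mulr_ge0 ?invr_ge0 ?(ltW d0) ?(ltW m_gt0).
  apply: (kernel_tail_split etaP hL1 L0 w0 dd0 Ieta0); last exact: htail.
  by move=> y; exact: (modular_translate_le etaP mf).
have I2 : (\int[leb]_x G2 x <= (h0^-1 * H)%:E * omega eta lam f H)%E.
  by apply: (modular_average_le lam etaP mf) => //; exact: ltW.
have I3 : (\int[leb]_x G3 x = e%:E * modular phi (fun x => (l * f x)%R))%E.
  rewrite ge0_integralZl_EFin//; first by move=> x _; rewrite lee_fin phi0.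
  by apply: (measurable_eta_comp phiP); exact: measurable_funM.
apply: (le_trans (lee_wpmul2l _ (leeD (leeD I1 I2) (lexx _)))); first by rewrite lee_fin.
(* All quantities are finite, and the remaining comparison is an identity of real numbers, with
   [h0^-1 * H = Delta / delta]. *)
rewrite I3 -/d -/H -/e -(fineK om1) -(fineK om2) -(fineK Iphi) -(fineK Ieta).
rewrite -!(EFinM, EFinD) lee_fin le_eqVlt; apply/orP; left; apply/eqP.
rewrite /H /h0; field.
by rewrite !gt_eqF.
Qed.
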